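(* Let $I=(-1,1)$ and let $\psi\in C(\bar I)$ be a symmetric cone, i.e. $\psi(x)=\psi(-x)$ for all $x$ and $\psi$ is affine on $(0,1)$, such that $\psi(\pm1)<0$ and $h:=\psi(0)>0$. Let $$X_\psi=\{u\in W^{2,2}(I): u(\pm1)=0,\ u\ge\psi \text{ on } I\},\qquad X_{\psi,\mathrm{sym}}=\{u\in X_\psi: u(x)=u(-x)\},$$ and $B[u]=\int_I u''(x)^2(1+u'(x)^2)^{-5/2}\,dx$ (the total squared curvature of the graph of $u$). Let $c_*=\int_0^{\pi/2}\sqrt{\cos\varphi}\,d\varphi$ and $h_*=2/c_*$. If $h<h_*$, then there exists a unique $\bar u\in X_{\psi,\mathrm{sym}}$ with $B[\bar u]=\inf_{X_{\psi,\mathrm{sym}}}B$. If $h\ge h_*$, then there is no minimizer of $B$ in $X_{\psi,\mathrm{sym}}$, and there is no minimizer of $B$ in $X_\psi$.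
   Context: A minimizer of $B$ in a class $Y$ means an element $u\in Y$ with $B[u]=\inf_{v\in Y}B[v]$. Numerically $h_*\approx1.66925$. *)

(* Defs.v *)
From HB Require Import structures.
From mathcomp Require Import all_boot all_order all_algebra.
From mathcomp Require Import all_classical all_reals all_analysis.
Set Implicit Arguments. Unset Strict Implicit. Unset Printing Implicit Defensive.
Import Order.TTheory GRing.Theory Num.Theory.
Import numFieldNormedType.Exports.
Local Open Scope classical_set_scope.
Local Open Scope ring_scope.

Section Defs.
Variable R : realType.
Local Notation mu := (@lebesgue_measure R).

(* (du, ddu) represents the first and (weak) second derivative of u on
   the closed interval [-1,1], with ddu in L^2(-1,1).  u is in W^{2,2}(-1,1)
   iff such a pair exists (1D characterisation of W^{2,2} on an interval). *)
Definition W22_rep (u du ddu : R -> R) : Prop :=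
  measurable_fun `[(-1 : R), 1] ddu /\
  mu.-integrable `[(-1 : R), 1] (fun x => (ddu x)%:E) /\
  mu.-integrable `[(-1 : R), 1] (fun x => ((ddu x) ^+ 2)%:E) /\
  (forall x, x \in `[(-1 : R), 1] ->
     du x = du (-1) + Rintegral mu `[(-1 : R), x] ddu) /\
  (forall x, x \in `[(-1 : R), 1] ->
     u x = u (-1) + Rintegral mu `[(-1 : R), x] du).

Definition W22 (u : R -> R) : Prop := exists du ddu, W22_rep u du ddu.

Definition Bcurv (du ddu : R -> R) : \bar R :=
  (\int[mu]_(x in `[(-1)%R : R, 1%R])
     ((((ddu x) ^+ 2) * (1 + (du x) ^+ 2) `^ (- (5%:R / 2)))%R)%:E)%E.

(* B[u]; the value does not depend on the chosen representation
   (weak derivatives are unique a.e.), so we take the inf over them;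
   B u = +oo if u is not in W^{2,2}. *)
Definition B (u : R -> R) : \bar R :=
  ereal_inf [set b | exists du ddu, W22_rep u du ddu /\ b = Bcurv du ddu].

Definition Xpsi (psi : R -> R) : set (R -> R) :=
  [set u | W22 u /\ u (-1) = 0 /\ u 1 = 0 /\
           (forall x, x \in `](-1 : R), 1[ -> psi x <= u x)].

Definition Xpsi_sym (psi : R -> R) : set (R -> R) :=
  [set u | Xpsi psi u /\ (forall x, x \in `](-1 : R), 1[ -> u x = u (- x))].

Definition is_minimizer (Y : set (R -> R)) (u : R -> R) : Prop :=
  Y u /\ B u = ereal_inf (B @` Y).

Definition c_star : R := Rintegral mu `[(0 : R), pi / 2] (fun phi => Num.sqrt (cos phi)).
Definition h_star : R := 2 / c_star.

End Defs.

(* Main.v *)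
(* Put S(x) = int_0^x sqrt(sin), so that c_* = S(pi/2), and let al be the largest
   descent angle of u on [0, 1], where u'(0) = 0. Since (1 + u'^2)^(-5/4) u'' times
   sqrt(sin al + u' cos al) is the derivative of S(al + atan u'), the Cauchy-Schwarz
   inequality bounds the energy E of the right half by
     S(al)^2 <= E (sin al - u(0) cos al),
   that is, 2 m S(al) - m^2 (sin al - u(0) cos al) <= E for all m.
   If u(0) >= h_*, then S(al) > c_* sqrt(sin al) - cos al / sqrt(sin al) gives
   E > c_*^2; applied on both sides of a maximum point of u, it gives B[u] > 2 c_*^2
   without any symmetry assumption. Arcs of the free elastica followed by
   straight segments show that 2 c_*^2 is the infimum, so it is not attained.
   If h < h_*, there is exactly one angle al at which the right-hand side with
   u(0) = h and the optimal m is minimal, and an arc of the free elastica turning by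
   al attains this minimum. Equality forces the first order equation
     (1 + u'^2)^(-5/4) u'' = - m sqrt(sin al + u' cos al),
   whose right-hand side is decreasing in u', so its solution is unique. *)
Require Import Defs.
From HB Require Import structures.
From mathcomp Require Import all_boot all_order all_algebra.
From mathcomp Require Import all_classical all_reals all_analysis.
From mathcomp Require Import measurable_realfun ring lra.
Import Order.TTheory GRing.Theory Num.Theory.
Import numFieldNormedType.Exports.
Local Open Scope classical_set_scope.
Local Open Scope ring_scope.
Set Implicit Arguments. Unset Strict Implicit.

(** * Calculus on intervals *)

Section calculus.
Variable R : realType.
Local Notation mu := (@lebesgue_measure R).
Implicit Types (f g q F phi : R -> R) (s t x y z : R).

(** The root of [sin al + u' cos al] comes from the first integral of the free elastica: its squared
    curvature is proportional to the sine of the angle with the inflection tangent. The radicand is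
    affine in [u'], so its integral depends only on the width and height of the arc, and the mixed
    term is exact; hence the square [(a g + m b)^2] integrates to the energy plus terms in [al], [m]
    and boundary data. The steepest point is the place to stop: there the turning term
    [S (al + atan u')] vanishes, and beyond it an optimal curve is straight. The formal obstacle is
    that [B] is an infimum over representatives. The continuous slope [f] is determined by [u], the
    second derivative only almost everywhere. So [f] is fixed, every bound is proved for all
    admissible second derivatives at once, with [al] depending on [f] alone, and the equality case
    is run with near-minimal ones: each discarded nonnegative term is smaller than every positive
    [e], which yields an integrated equation free of the second derivative. *)

Lemma local_incr phi s t : s <= t ->
  (forall c, c \in `[s, t] -> exists2 e, 0 < e &
     forall x y, x \in `[s, t] -> y \in `[s, t] -> x <= y ->
       `|x - c| < e -> `|y - c| < e -> phi x <= phi y) ->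
  phi s <= phi t.
Proof.
(* The neighbourhood of [sup A] first gives [phi s <= phi (sup A)] and then, unless [sup A = t], a
   point of [A] beyond the supremum. *)
move=> st H; pose A := [set x | x \in `[s, t] /\ phi s <= phi x].
have As : A s by split; rewrite ?in_itv/= ?lexx.
have ubA : has_sup A.
  by split; [exists s | exists t => x [] /=; rewrite in_itv/= => /andP[]].
have sc : s <= sup A by apply: ub_le_sup => //; case: ubA.
have ct : sup A <= t.
  by apply: ge_sup => [|x []]; [exists s | rewrite in_itv/= => /andP[]].
have cI : sup A \in `[s, t] by rewrite in_itv/= sc ct.
have [e e0 He] := H _ cI.
have [x [xI sx] xe] := sup_adherent e0 ubA.
have xc : x <= sup A by apply: ub_le_sup => //; case: ubA.
have sphi : phi s <= phi (sup A).
  apply: le_trans sx (He _ _ xI cI xc _ _); last by rewrite subrr normr0.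
  by rewrite ler0_norm ?subr_le0// opprB ltrBlDr addrC -ltrBlDr.
move: ct; rewrite le_eqVlt => /orP[/eqP <-//|ct].
pose y := Num.min t (sup A + e / 2).
have cy : sup A < y by rewrite lt_min ct ltrDl divr_gt0.
have yI : y \in `[s, t] by rewrite in_itv/= ge_min lexx/= (le_trans sc)// ltW.
have : A y.
  split=> //; apply: le_trans sphi (He _ _ cI yI (ltW cy) _ _).
    by rewrite subrr normr0.
  rewrite gtr0_norm ?subr_gt0// ltrBlDl gt_min.
  by apply/orP; right; rewrite ltrD2l ltr_pdivrMr// ltr_pMr// ltr1n.
by move=> /(ub_le_sup (proj2 ubA)); rewrite leNgt cy.
Qed.

Lemma continuous_integrable phi s t : continuous phi ->
  mu.-integrable `[s, t] (EFin \o phi).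
Proof.
move=> cphi; apply: continuous_compact_integrable; first exact: segment_compact.
exact: continuous_subspaceT.
Qed.

Lemma integrable_continuousM phi g s t : continuous phi ->
  mu.-integrable `[s, t] (EFin \o g) ->
  mu.-integrable `[s, t] (EFin \o (fun x => phi x * g x)).
Proof.
move=> cphi ig; rewrite (_ : EFin \o _ = (EFin \o phi) \* (EFin \o g))%E //.
apply: integrableMr => //.
  by apply: measurable_funTS; exact: continuous_measurable_fun.
have cpt : compact [set phi x | x in `[s, t]].
  apply: continuous_compact; last exact: segment_compact.
  exact: continuous_subspaceT.
have [M [Mr HM]] := compact_bounded cpt.
by exists M; split => // r Mr' x xI; apply: (HM r Mr'); exists x.
Qed.

Lemma integrableDr phi g s t :
  mu.-integrable `[s, t] (EFin \o phi) -> mu.-integrable `[s, t] (EFin \o g) ->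
  mu.-integrable `[s, t] (EFin \o (fun x => phi x + g x)).
Proof. by move=> iphi ig; exact: (integrableD _ iphi ig). Qed.

Lemma integrableBr phi g s t :
  mu.-integrable `[s, t] (EFin \o phi) -> mu.-integrable `[s, t] (EFin \o g) ->
  mu.-integrable `[s, t] (EFin \o (fun x => phi x - g x)).
Proof. by move=> iphi ig; exact: (integrableB _ iphi ig). Qed.

Lemma integrableNr g s t : mu.-integrable `[s, t] (EFin \o g) ->
  mu.-integrable `[s, t] (EFin \o (fun x => - g x)).
Proof.
move=> ig; have := integrableN ig.
by apply: eq_integrable => // x _; rewrite /= EFinN.
Qed.

Lemma Rintegral_split phi x y z : x <= y -> y <= z ->
  mu.-integrable `[x, z] (EFin \o phi) ->
  Rintegral mu `[x, z] phi = Rintegral mu `[x, y] phi + Rintegral mu `[y, z] phi.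
Proof.
move=> xy yz ig.
have := @Rintegral_itvB R phi (BLeft x) (BRight z) y ig.
rewrite !bnd_simp => /(_ xy yz) H.
rewrite -(@Rintegral_itv_obnd_cbnd R y (BRight z)); last first.
  apply: integrableS ig => //; apply: subset_itv; rewrite bnd_simp//.
by rewrite -H addrCA subrr addr0.
Qed.

Lemma integrable_sub phi x y s t : s <= x -> y <= t ->
  mu.-integrable `[s, t] (EFin \o phi) -> mu.-integrable `[x, y] (EFin \o phi).
Proof.
by move=> sx yt; apply: integrableS => //; apply: subset_itv; rewrite bnd_simp.
Qed.

Lemma is_derive_Rintegral phi s x : s < x -> continuous phi ->
  is_derive x 1 (fun y => Rintegral mu `[s, y] phi) (phi x).
Proof.
move=> sx cphi.
have xx1 : x < x + 1 by rewrite ltrDl.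
have [] := @continuous_FTC1_closed R phi s x (x + 1) xx1
  (@continuous_integrable phi s (x + 1) cphi) sx (cphi x).
by move=> dF; rewrite derive1E => eF; apply: DeriveDef.
Qed.

Lemma is_derive_continuous F x (l : R) : is_derive x 1 F l -> {for x, continuous F}.
Proof. by move=> [dF _]; apply/differentiable_continuous/derivable1_diffP. Qed.

Lemma Rintegral_FTC2 phi F s t : s <= t -> continuous phi ->
  (forall x, x \in `]s, t[ -> is_derive x 1 F (phi x)) ->
  {within `[s, t], continuous F} ->
  Rintegral mu `[s, t] phi = F t - F s.
Proof.
move=> + cphi dF cF; rewrite le_eqVlt => /orP[/eqP <-|st].
  by rewrite set_itv1 Rintegral_set1 subrr.
rewrite /Rintegral (@continuous_FTC2 _ phi F)//.
- exact: continuous_subspaceT.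
- move/(continuous_within_itvP _ st) : cF => [_ c1 c2]; split => //.
  by move=> x xI; case: (dF x xI).
- by move=> x xI; rewrite derive1E; case: (dF x xI).
Qed.

Lemma derive_within_continuous (F F' : R -> R) s t :
  (forall x, x \in `[s, t] -> is_derive x 1 F (F' x)) ->
  {within `[s, t], continuous F}.
Proof.
move=> dF; apply: continuous_in_subspaceT => x; rewrite inE => xI.
exact: is_derive_continuous (dF x xI).
Qed.

Lemma Rintegral_FTC2_cc phi F s t : s <= t -> continuous phi ->
  (forall x, x \in `[s, t] -> is_derive x 1 F (phi x)) ->
  Rintegral mu `[s, t] phi = F t - F s.
Proof.
move=> st cphi dF.
have cF : {within `[s, t], continuous F} by apply: derive_within_continuous dF.
have dF' : forall x, x \in `]s, t[ -> is_derive x 1 F (phi x).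
  by move=> x xI; apply: dF; exact: (subset_itv_oo_cc xI).
exact: (@Rintegral_FTC2 phi F s t st cphi dF' cF).
Qed.

Lemma is_derive_cst_itv F s t : s <= t ->
  (forall x, x \in `]s, t[ -> is_derive x 1 F 0) ->
  {within `[s, t], continuous F} -> F t = F s.
Proof.
move=> st dF cF; have [c _] := @MVT_segment R F (fun=> 0) s t st dF cF.
by rewrite mul0r => /eqP; rewrite subr_eq0 => /eqP.
Qed.

Lemma is_derive_chain_comp F f x (a b d : R) :
  is_derive (f x) 1 F a -> is_derive x 1 f b -> d = a * b ->
  is_derive x 1 (fun y => F (f y)) d.
Proof. by move=> dF df ->; exact: is_derive1_comp. Qed.

End calculus.

(** * Chain rule along absolutely continuous functions *)

Section chain_rule.
Variable R : realType.
Local Notation mu := (@lebesgue_measure R).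
Implicit Types (f g q F phi : R -> R) (s t x y z : R).

(** Continuity of [f] is asked on the whole line, so that compositions with [f] are continuous
    without subspace topologies; only the integral identity is local to [[s, t]]. *)
Definition ac f g s t := [/\ continuous f, mu.-integrable `[s, t] (EFin \o g) &
  forall x y, s <= x -> x <= y -> y <= t -> f y - f x = Rintegral mu `[x, y] g].

Lemma MVT_between F q x y : (forall z, is_derive z 1 F (q z)) ->
  exists2 z, (Num.min x y <= z <= Num.max x y) & F y - F x = q z * (y - x).
Proof.
move=> dF.
have cF a b : {within `[a, b], continuous F}.
  by apply: continuous_subspaceT => z; exact: is_derive_continuous (dF z).
have [xy|/ltW yx] := leP x y.
  have [c] := @MVT_segment R F q x y xy (fun z _ => dF z) (cF x y).
  by rewrite in_itv/= => cI ->; exists c.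
have [c] := @MVT_segment R F q y x yx (fun z _ => dF z) (cF y x).
rewrite in_itv/= => cI H; exists c => //.
by apply/eqP; rewrite -(inj_eq oppr_inj) opprB H -mulrN opprB.
Qed.

(** By the mean value theorem the increment of [F \o f] is [q z] times the integral of [g], with [z]
    between [f x] and [f y]; near [c], [q z] and [q (f u)] differ by at most [e]. *)
Lemma ac_chain_local F q f g s t : ac f g s t ->
  (forall z, is_derive z 1 F (q z)) -> continuous q ->
  forall e, 0 < e -> forall c, c \in `[s, t] -> exists2 d, 0 < d &
     forall x y, x \in `[s, t] -> y \in `[s, t] -> x <= y ->
       `|x - c| < d -> `|y - c| < d ->
    `|F (f y) - F (f x) - Rintegral mu `[x, y] (fun u => q (f u) * g u)| <=
    e * Rintegral mu `[x, y] (fun u => `|g u|).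
Proof.
move=> [cf ig fg] dF cq e e0 c cI.
have e20 : 0 < e / 2 by rewrite divr_gt0.
have /cvgrPdist_lt/(_ _ e20) := cq (f c).
move=> /nbhs_ballP[d1 /= d10 Hd1].
have /cvgrPdist_lt/(_ _ d10) := cf c.
move=> /nbhs_ballP[d /= d0 Hd].
exists d => // x y; rewrite !in_itv/= => /andP[sx xt] /andP[sy yt] xy xc yc.
have near u : x <= u -> u <= y -> `|f c - f u| < d1.
  move=> xu uy; apply: Hd; rewrite /ball/= distrC.
  move: xc yc; rewrite !ltr_norml => /andP[? ?] /andP[? ?].
  by apply/andP; split; lra.
have [z /andP[z1 z2] ->] := MVT_between (f x) (f y) dF.
have zc : `|f c - z| < d1.
  move: (near x (lexx _) xy) (near y xy (lexx _)); rewrite !ltr_norml.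
  move: z1 z2; rewrite ge_min le_max => z1 z2 /andP[? ?] /andP[? ?].
  by case/orP: z1 => ?; case/orP: z2 => ?; apply/andP; split; lra.
have qz u : x <= u -> u <= y -> `|q z - q (f u)| <= e.
  move=> xu uy; have := Hd1 z zc; have := Hd1 (f u) (near u xu uy).
  rewrite /= !ltr_norml ler_norml => /andP[? ?] /andP[? ?].
  by apply/andP; split; lra.
have igxy : mu.-integrable `[x, y] (EFin \o g) by exact: integrable_sub ig.
have iabs : mu.-integrable `[x, y] (EFin \o (fun u => `|g u|)).
  exact: integrable_norm igxy.
have cqf : continuous (q \o f) by move=> u; exact: continuous_comp (cf u) (cq _).
have iq := @integrable_continuousM R (q \o f) g x y cqf igxy.
have izg : mu.-integrable `[x, y] (EFin \o (fun u => q z * g u)).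
  by apply: integrable_continuousM => // ?; exact: cvg_cst.
rewrite (fg x y)// -RintegralZl// -RintegralB//.
apply: le_trans (le_normr_Rintegral _ _) _ => //=.
  exact: (integrableBr izg iq).
rewrite -RintegralZl//; apply: le_Rintegral => //=.
- apply: integrable_norm.
  exact: (integrableBr izg iq).
- by apply: integrable_continuousM => // ?; exact: cvg_cst.
- move=> u; rewrite /= in_itv/= => /andP[xu uy].
  by rewrite -mulrBl normrM ler_wpM2r// qz.
Qed.

(** Since [g] is merely integrable, [F \o f] need not be differentiable everywhere. Instead, the
    defect [D] of the formula has local increments bounded by [e] times those of the integral [A] of
    [|g|], so [e * A + D] and [e * A - D] are increasing for every [e]. *)
Lemma ac_chain F q f g s t : s <= t -> ac f g s t ->
  (forall z, is_derive z 1 F (q z)) -> continuous q ->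
  F (f t) - F (f s) = Rintegral mu `[s, t] (fun x => q (f x) * g x).
Proof.
move=> st acfg dF cq; have [cf ig fg] := acfg.
pose h u := q (f u) * g u.
pose A x := Rintegral mu `[s, x] (fun u => `|g u|).
pose D x := F (f x) - Rintegral mu `[s, x] h.
have iabs : mu.-integrable `[s, t] (EFin \o (fun u => `|g u|)).
  exact: integrable_norm ig.
have cqf : continuous (q \o f) by move=> u; exact: continuous_comp (cf u) (cq _).
have iq := @integrable_continuousM R (q \o f) g s t cqf ig.
have incr phi x y : mu.-integrable `[s, t] (EFin \o phi) -> s <= x -> x <= y ->
    y <= t -> Rintegral mu `[s, y] phi =
    Rintegral mu `[s, x] phi + Rintegral mu `[x, y] phi.
  move=> iphi sx xy yt; apply: Rintegral_split => //.
  by apply: integrable_sub iphi.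
have base phi : Rintegral mu `[s, s] phi = 0 by rewrite set_itv1 Rintegral_set1.
suff H e : 0 < e -> `|D t - D s| <= e * A t.
  have DD : D t - D s = 0.
    apply/eqP; rewrite -normr_le0; apply/ler_addgt0Pr => e e0; rewrite add0r.
    have A0 : 0 <= A t by apply: Rintegral_ge0 => x _; exact: normr_ge0.
    have A1 : 0 < A t + 1 by rewrite ltr_wpDl.
    apply: le_trans (H (e / (A t + 1)) _) _; first by rewrite divr_gt0.
    by rewrite mulrAC ler_pdivrMr// ler_wpM2l ?ltW// ltrDl.
  move: DD; rewrite /D base subr0 -/h => DD.
  by apply/eqP; rewrite -subr_eq0 addrAC DD.
move=> e0; have L := ac_chain_local acfg dF cq e0.
have loc (sg : R) : sg = 1 \/ sg = -1 ->
    e * A s - sg * D s <= e * A t - sg * D t.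
  move=> sgE; apply: (@local_incr R (fun x => e * A x - sg * D x)) => // c cI.
  have [d d0 Hd] := L c cI; exists d => // x y xI yI xy xc yc.
  have := Hd x y xI yI xy xc yc.
  move: xI yI; rewrite !in_itv/= => /andP[sx xt] /andP[sy yt].
  rewrite /A /D (incr _ x y iabs)// (incr _ x y iq)// -/h.
  rewrite ler_norml => /andP[].
  set I1 := Rintegral _ _ _; set I2 := Rintegral _ _ _.
  set I3 := Rintegral _ _ _; set I4 := Rintegral _ _ _.
  by case: sgE => ->; rewrite ?mulN1r ?mul1r !mulrDr; lra.
have := loc 1 (or_introl erefl); have := loc (-1) (or_intror erefl).
rewrite /A base ler_norml -/(A t) !mulr0 !mulN1r !mul1r => h1 h2.
by apply/andP; split; lra.
Qed.

Lemma ac_sub f g s t x y : s <= x -> y <= t -> ac f g s t -> ac f g x y.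
Proof.
move=> sx yt [cf ig fg]; split=> //; first exact: integrable_sub ig.
by move=> a b xa ab bY; apply: fg => //; [exact: le_trans xa|exact: le_trans bY yt].
Qed.

Lemma acN f g s t : ac f g s t -> ac (fun x => - f x) (fun x => - g x) s t.
Proof.
move=> [cf ig fg]; split.
- by move=> x; apply: continuousN; exact: cf.
- exact: integrableNr.
- move=> x y sx xy yt.
  rewrite -opprD fg// -mulN1r -RintegralZl//; last exact: integrable_sub ig.
  by apply: eq_Rintegral => z _; rewrite mulN1r.
Qed.

End chain_rule.

(** * Angles and turning integrals *)

Section elastica_functions.
Variable R : realType.
Local Notation mu := (@lebesgue_measure R).
Implicit Types (x y d al m h : R).

Definition rtsin x : R := Num.sqrt (sin x).

(* The base point -4 lies below every [al + atan d] with [0 <= al], so that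
   [S] is differentiable wherever it is used. *)
Definition S x : R := Rintegral mu `[-4, x] rtsin - Rintegral mu `[-4, 0] rtsin.

(** [k d] is [(1 + d^2)^(-1/2)], so [a d] is the square root of the curvature weight;
    [k d * b al d ^+ 2] is [sin (al + atan d)] wherever this is nonnegative. *)
Definition k d : R := cos (atan d).
Definition a d : R := Num.sqrt (k d) * k d ^+ 2.
Definition b al d : R := Num.sqrt (sin al + d * cos al).

Lemma continuous_rtsin : continuous rtsin.
Proof.
by move=> x; apply: continuous_comp; [exact: continuous_sin|exact: sqrt_continuous].
Qed.

Lemma rtsin_ge0 x : 0 <= rtsin x. Proof. exact: sqrtr_ge0. Qed.

Lemma rtsin_gt0 x : 0 < sin x -> 0 < rtsin x.
Proof. by rewrite sqrtr_gt0. Qed.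

Lemma sqr_rtsin x : 0 <= sin x -> rtsin x ^+ 2 = sin x.
Proof. exact: sqr_sqrtr. Qed.

Lemma rtsin0 : rtsin 0 = 0. Proof. by rewrite /rtsin sin0 sqrtr0. Qed.

Lemma rtsin_pihalf : rtsin (pi / 2) = 1.
Proof. by rewrite /rtsin sin_pihalf sqrtr1. Qed.

Lemma is_derive_rtsin x : 0 < sin x ->
  is_derive x 1 rtsin (cos x / (2 * rtsin x)).
Proof.
move=> sx; apply: (@is_derive_chain_comp R Num.sqrt sin x _ _ _ (is_derive1_sqrt sx)).
by rewrite mulrC.
Qed.

Lemma S0 : S 0 = 0. Proof. by rewrite /S subrr. Qed.

Lemma is_derive_S x : -4 < x -> is_derive x 1 S (rtsin x).
Proof.
move=> x4; rewrite -[rtsin x]subr0 /S.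
have := is_derive_Rintegral x4 continuous_rtsin => H.
exact: is_deriveB.
Qed.

Lemma continuous_S x : -4 < x -> {for x, continuous S}.
Proof. by move=> /is_derive_S; exact: is_derive_continuous. Qed.

Lemma pihalf_lt4 : pi / 2 < 4 :> R.
Proof. by have := @pihalf_lt2 R; lra. Qed.

Lemma S_within x y : -4 < x -> {within `[x, y], continuous S}.
Proof.
move=> x4; apply: continuous_in_subspaceT => z; rewrite inE/= in_itv/= => /andP[xz _].
exact/continuous_S/(lt_le_trans x4).
Qed.

Lemma S_MVT x y : -4 < x -> x < y ->
  exists2 z, x < z < y & S y - S x = rtsin z * (y - x).
Proof.
move=> x4 xy; have d z : z \in `]x, y[ -> is_derive z 1 S (rtsin z).
  by rewrite in_itv/= => /andP[xz _]; exact: is_derive_S (lt_trans x4 xz).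
by have [z] := MVT xy d (S_within (y := y) x4); rewrite in_itv/= => zI; exists z.
Qed.

Lemma S_le x y : -4 < x -> x <= y -> S x <= S y.
Proof.
move=> x4; rewrite le_eqVlt => /orP[/eqP <-//|xy].
have [z _] := S_MVT x4 xy; rewrite -subr_ge0 => ->.
by rewrite mulr_ge0 ?rtsin_ge0// subr_ge0 ltW.
Qed.

Lemma S_lt x y : 0 <= x -> x < y -> y <= pi -> S x < S y.
Proof.
move=> x0 xy yp; have x4 : -4 < x by lra.
have [z /andP[xz zy]] := S_MVT x4 xy; rewrite -subr_gt0 => ->.
rewrite mulr_gt0 ?subr_gt0// rtsin_gt0// sin_gt0_pi//.
by rewrite (le_lt_trans x0)//= (lt_le_trans zy).
Qed.

Lemma S_gt0 x : 0 < x <= pi / 2 -> 0 < S x.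
Proof.
by move=> /andP[x0 xp]; rewrite -S0 S_lt//; have := @pi_gt0 R; lra.
Qed.

Lemma c_starE : c_star R = S (pi / 2).
Proof.
rewrite /c_star; apply: etrans.
  apply: (@Rintegral_FTC2_cc _ _ (fun x => - S (pi / 2 - x))).
  - by apply: ltW; rewrite divr_gt0// pi_gt0.
  - by move=> x; apply: continuous_comp; [exact: continuous_cos|exact: sqrt_continuous].
  - move=> x; rewrite in_itv/= => /andP[x0 xp].
    have H : is_derive (pi / 2 - x) 1 S (rtsin (pi / 2 - x)).
      by apply: is_derive_S; lra.
    have Hi : is_derive x 1 (fun x => pi / 2 - x) (-1).
      by apply: is_derive_eq; ring.
    have H2 : is_derive x 1 (fun x => S (pi / 2 - x)) (- rtsin (pi / 2 - x)).
      by apply: (@is_derive_chain_comp R S (fun x => pi / 2 - x) x _ _ _ H Hi); rewrite mulrN1.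
    have := is_deriveN H2; rewrite opprK.
    by rewrite /rtsin sinB sin_pihalf cos_pihalf mul1r mul0r subr0 => H3; exact: H3.
by rewrite /= subr0 subrr S0 oppr0 sub0r opprK.
Qed.

(** Here [cos x <= sqrt (cos x)] is integrated. The bound puts [h_star] below 2, the range of
    heights in which the optimal angle is shown to be unique. *)
Lemma c_star_ge1 : 1 <= c_star R.
Proof.
have p0 : 0 < pi / 2 :> R by rewrite divr_gt0// pi_gt0.
have E1 : Rintegral mu `[0, pi / 2] cos = 1.
  transitivity (sin (pi / 2) - sin 0 : R); last by rewrite sin_pihalf sin0 subr0.
  apply: (@Rintegral_FTC2_cc R cos sin 0 (pi / 2) (ltW p0) (@continuous_cos R)).
rewrite -[leLHS]E1; apply: le_Rintegral => //.
- exact: (continuous_integrable 0 (pi / 2) (@continuous_cos R)).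
- apply: continuous_integrable => x; apply: continuous_comp;
    [exact: continuous_cos|exact: sqrt_continuous].
- move=> x /=; rewrite in_itv/= => /andP[x0 xp].
  have c0 : 0 <= cos x by apply: cos_ge0_pihalf; lra.
  by rewrite -[leLHS]ger0_norm// -sqrtr_sqr ler_sqrt// expr2 ler_piMr// cos_le1.
Qed.

(** The derivative of [cos / rtsin] cancels that of [S], so the difference [M] of the two sides has
    a derivative made of negative terms only, and [M] vanishes at [pi / 2]. *)
Lemma S_lower al : 0 < al < pi / 2 ->
  c_star R * rtsin al - cos al / rtsin al < S al.
Proof.
move=> /andP[al0 alp]; set c := c_star R.
pose M x := S x - (c * rtsin x - cos x / rtsin x).
pose M' x := - (cos x * (c / (2 * rtsin x)) + cos x ^+ 2 / (2 * rtsin x ^+ 3)).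
have sgt0 x : al <= x -> x <= pi / 2 -> 0 < sin x.
  by move=> ax xp; apply: sin_gt0_pi; have := @pi_gt0 R; lra.
have dM x : al <= x -> x <= pi / 2 -> is_derive x 1 M (M' x).
  move=> ax xp; have sx := sgt0 x ax xp; have rx := rtsin_gt0 sx.
  have rx0 : rtsin x != 0 by rewrite gt_eqF.
  have d1 : is_derive x 1 S (rtsin x) by apply: is_derive_S; lra.
  have d2 := is_derive_rtsin sx.
  rewrite /M; apply: is_derive_eq; rewrite /M' /GRing.scale/=.
  have rs := sqr_rtsin (ltW sx).
  have cs := cos2Dsin2 x; rewrite -rs in cs.
  by rewrite -rs; field.
have cM : {within `[al, pi / 2], continuous M}.
  by apply: (@derive_within_continuous _ _ M') => x; rewrite in_itv => /andP[]; exact: dM.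
have [x] := MVT alp (fun z zI => dM z (ltW (proj1 (andP zI))) (ltW (proj2 (andP zI)))) cM.
rewrite in_itv/= => /andP[ax xp].
have cx : 0 < cos x by apply: cos_gt0_pihalf; lra.
have rx := rtsin_gt0 (sgt0 x (ltW ax) (ltW xp)).
have c0 : 0 < c by apply: lt_le_trans c_star_ge1.
have : M' x < 0.
  by rewrite oppr_lt0 addr_gt0// ?mulr_gt0 ?invr_gt0 ?mulr_gt0 ?exprn_gt0.
move=> M'0 MM; have : M (pi / 2) - M al < 0.
  by rewrite MM nmulr_rlt0// subr_gt0.
rewrite /M cos_pihalf mul0r rtsin_pihalf /c c_starE; lra.
Qed.

Lemma k_gt0 d : 0 < k d.
Proof. by apply: cos_gt0_pihalf; rewrite atan_gtNpi2 atan_ltpi2. Qed.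

Lemma sin_atanE d : sin (atan d) = d * k d.
Proof. by have := atanK d; rewrite /tan => /(canRL (mulfVK (lt0r_neq0 (k_gt0 d)))) ->. Qed.

Lemma sqr_k d : k d ^+ 2 = (1 + d ^+ 2)^-1.
Proof. by rewrite /k cos_atan exprVn sqr_sqrtr// addr_ge0// sqr_ge0. Qed.

Lemma weightE d : (1 + d ^+ 2) `^ (- (5%:R / 2)) = k d ^+ 5.
Proof.
have d0 : 0 <= 1 + d ^+ 2 by rewrite addr_ge0// sqr_ge0.
rewrite powRN mulrC powRrM powR12_sqrt// powR_mulrn ?sqrtr_ge0//.
by rewrite /k cos_atan exprVn.
Qed.

Lemma continuous_k : continuous k.
Proof.
by move=> x; apply: continuous_comp; [exact: continuous_atan|exact: continuous_cos].
Qed.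

Lemma sqr_a d : a d ^+ 2 = k d ^+ 5.
Proof. by rewrite exprMn sqr_sqrtr ?ltW ?k_gt0//; ring. Qed.

Lemma sin_addatan al d : sin (al + atan d) = k d * (sin al + d * cos al).
Proof. by rewrite sinD sin_atanE -/(k d); ring. Qed.

Lemma continuous_a : continuous a.
Proof.
move=> x; have c1 : {for x, continuous (fun d => Num.sqrt (k d))}.
  by apply: continuous_comp; [exact: continuous_k|exact: sqrt_continuous].
exact: (cvgM c1 (cvgM (@continuous_k x) (@continuous_k x))).
Qed.

Lemma continuous_b al : continuous (b al).
Proof.
move=> x; have c1 : {for x, continuous (fun d => sin al + d * cos al)}.
  by apply: cvgD; [exact: cvg_cst|apply: cvgM; [exact: cvg_id|exact: cvg_cst]].
by apply: continuous_comp c1 _; exact: sqrt_continuous.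
Qed.

Lemma sqr_b al d : 0 <= sin al + d * cos al -> b al d ^+ 2 = sin al + d * cos al.
Proof. exact: sqr_sqrtr. Qed.

Lemma b_pihalf d : b (pi / 2) d = 1.
Proof. by rewrite /b cos_pihalf sin_pihalf mulr0 addr0 sqrtr1. Qed.

(* [a * b al] is the derivative of the first integral of the elastica. *)
Lemma is_derive_Q al d : 0 <= al ->
  is_derive d 1 (fun d => S (al + atan d)) (a d * b al d).
Proof.
move=> al0.
have p : -4 < al + atan d.
  by have := atan_gtNpi2 d; have := @pihalf_lt4; lra.
have di : is_derive d 1 (fun d => al + atan d) (1 + d ^+ 2)^-1.
  by apply: is_derive_eq; ring.
apply: (@is_derive_chain_comp R S (fun d => al + atan d) d _ _ _ (is_derive_S p) di).
rewrite  -sqr_k /a /b /rtsin sin_addatan sqrtrM ?ltW ?k_gt0//.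
by rewrite mulrAC.
Qed.

End elastica_functions.

(** * Energy of an arc *)

Section energy_bounds.
Variable R : realType.
Local Notation mu := (@lebesgue_measure R).
Implicit Types (f g : R -> R) (s t x al m H : R).

Definition E f g s t : R :=
  Rintegral mu `[s, t] (fun x => k (f x) ^+ 5 * g x ^+ 2).

Definition ac2 f g s t :=
  ac f g s t /\ mu.-integrable `[s, t] (EFin \o (fun x => g x ^+ 2)).

Lemma ac2_sub f g s t x y : s <= x -> y <= t -> ac2 f g s t -> ac2 f g x y.
Proof.
move=> sx yt [acf ig2]; split; first exact: ac_sub acf.
exact: integrable_sub ig2.
Qed.

Lemma ac2N f g s t : ac2 f g s t -> ac2 (fun x => - f x) (fun x => - g x) s t.
Proof.
move=> [acf ig2]; split; first exact: acN.
by apply: eq_integrable ig2 => // x _; rewrite /= sqrrN.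
Qed.

Lemma continuous_k5 f : continuous f -> continuous (fun x => k (f x) ^+ 5).
Proof.
move=> cf x; have ck : {for x, continuous (fun x => k (f x))}.
  by apply: continuous_comp; [exact: cf|exact: continuous_k].
exact: (cvgM ck (cvgM ck (cvgM ck (cvgM ck ck)))).
Qed.

Lemma continuous_height al f : continuous f ->
  continuous (fun x => sin al + f x * cos al).
Proof.
move=> cf x; apply: cvgD; first exact: cvg_cst.
by apply: cvgM; [exact: cf|exact: cvg_cst].
Qed.

Lemma continuous_ab al : continuous (fun d : R => a d * b al d).
Proof. by move=> x; apply: cvgM; [exact: continuous_a|exact: continuous_b]. Qed.

Lemma integrable_E f g s t : ac2 f g s t ->
  mu.-integrable `[s, t] (EFin \o (fun x => k (f x) ^+ 5 * g x ^+ 2)).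
Proof.
move=> [[cf _ _] ig2]; apply: integrable_continuousM => //.
exact: continuous_k5.
Qed.

Lemma E_ge0 f g s t : 0 <= E f g s t.
Proof.
apply: Rintegral_ge0 => x _.
by rewrite mulr_ge0 ?sqr_ge0// exprn_ge0// ltW// k_gt0.
Qed.

Lemma E_split f g s x t : s <= x -> x <= t -> ac2 f g s t ->
  E f g s t = E f g s x + E f g x t.
Proof. by move=> sx xt acf; apply: Rintegral_split => //; exact: integrable_E. Qed.

Lemma EN f g s t : E (fun x => - f x) (fun x => - g x) s t = E f g s t.
Proof. by apply: eq_Rintegral => x _; rewrite /k atanN cosN sqrrN. Qed.

(** Completing the square: the mixed term is exact by [is_derive_Q], and where the radicand is
    nonnegative the square of [b] is the radicand itself. *)
Lemma square_integral al m f g s t : s <= t -> 0 <= al -> ac2 f g s t ->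
  (forall x, x \in `[s, t] -> 0 <= sin al + f x * cos al) ->
  Rintegral mu `[s, t] (fun x => (a (f x) * g x + m * b al (f x)) ^+ 2) =
  E f g s t + 2 * m * (S (al + atan (f t)) - S (al + atan (f s))) +
  m ^+ 2 * Rintegral mu `[s, t] (fun x => sin al + f x * cos al).
Proof.
move=> st al0 ac2f pos; have [acf ig2] := ac2f; have [cf ig _] := acf.
have iE := integrable_E ac2f.
have cab := @continuous_ab al.
have cabf : continuous (fun x => a (f x) * b al (f x)).
  by move=> x; exact: (@continuous_comp _ _ _ f (fun d : R => a d * b al d) x (cf x) (cab _)).
have iab := integrable_continuousM cabf ig.
have ich := continuous_integrable s t (continuous_height (al := al) cf).
have iZ c phi : mu.-integrable `[s, t] (EFin \o phi) ->
    mu.-integrable `[s, t] (EFin \o (fun x => c * phi x)).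
  by move=> ip; apply: integrable_continuousM ip => z; exact: cvg_cst.
rewrite (ac_chain st acf (fun d => is_derive_Q d al0) cab).
have i2 := iZ (2 * m) _ iab; have i3 := iZ (m ^+ 2) _ ich.
have i12 := integrableDr iE i2.
rewrite /E -!RintegralZl//.
rewrite -(RintegralD _ iE i2)// -(RintegralD _ i12 i3)//.
apply: eq_Rintegral => x; rewrite inE/= => xI.
rewrite -sqr_a -(sqr_b (pos x xI)); ring.
Qed.

(** At a minimum point [x] of [f], with [al = - atan (f x)], the expression [sin al + f y * cos al]
    equals [k (f x) * (f y - f x)]. *)
Lemma tan_max_slope f s t H : s < t -> continuous f -> 0 < H ->
  Rintegral mu `[s, t] f = - H ->
  exists al x, [/\ 0 < al < pi / 2, x \in `[s, t], al + atan (f x) = 0 &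
    forall y, y \in `[s, t] -> 0 <= sin al + f y * cos al].
Proof.
move=> st cf H0 fH.
have [x xI fx] := EVT_min (ltW st) (continuous_subspaceT (A := `[s, t]) cf).
have fx0 : f x < 0.
  rewrite ltNge; apply/negP => fx0; suff : 0 <= - H by lra.
  rewrite -fH; apply: Rintegral_ge0 => y yI; apply: le_trans fx0 (fx _ _).
  by move: yI; rewrite /= in_itv.
exists (- atan (f x)), x; split=> //.
- rewrite oppr_gt0 ltrNl atan_gtNpi2 andbT.
  by rewrite -(@atan0 R); exact: lt_atan.
- by rewrite addNr.
- move=> y yI; rewrite sinN cosN sin_atanE addrC -/(k (f x)) -mulrBl.
  by apply: mulr_ge0; [rewrite subr_ge0 fx|exact/ltW/k_gt0].
Qed.

Lemma height_integral al f s t H : s <= t -> continuous f ->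
  Rintegral mu `[s, t] f = - H ->
  Rintegral mu `[s, t] (fun x => sin al + f x * cos al) =
  (t - s) * sin al - H * cos al.
Proof.
move=> st cf fH.
have i1 : mu.-integrable `[s, t] (EFin \o (fun=> sin al)).
  by apply: continuous_integrable => z; exact: cvg_cst.
have i2 := continuous_integrable s t cf.
have i3 : mu.-integrable `[s, t] (EFin \o (fun x => f x * cos al)).
  by apply: continuous_integrable => z; apply: cvgM; [exact: cf|exact: cvg_cst].
rewrite RintegralD// RintegralZr// fH mulNr; congr (_ - _).
rewrite Rintegral_cst//= lebesgue_measure_itv/= lte_fin.
case: ltgtP st => // [st _|-> _]; first by rewrite -EFinD/= mulrC.
by rewrite subrr mul0r mulr0.
Qed.

(** An identity rather than an inequality: the three terms on the left are the nonnegative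
    remainders of the energy bound, and the equality case must show that each of them vanishes. The
    angle and the steepest point are chosen before [g]. *)
Lemma energy_right f s t H : s < t -> continuous f -> f s = 0 -> 0 < H ->
  Rintegral mu `[s, t] f = - H ->
  exists al x, [/\ 0 < al < pi / 2, x \in `[s, t], al + atan (f x) = 0,
    (forall y, y \in `[s, t] -> 0 <= sin al + f y * cos al) &
    forall g m, ac2 f g s t ->
      Rintegral mu `[s, x] (fun y => (a (f y) * g y + m * b al (f y)) ^+ 2) +
      (E f g x t + m ^+ 2 * Rintegral mu `[x, t] (fun y => sin al + f y * cos al)) =
      E f g s t - 2 * m * S al + m ^+ 2 * ((t - s) * sin al - H * cos al)].
Proof.
move=> st cf fs H0 fH.
have [al [x [/andP[al0 alp] xI alx pos]]] := tan_max_slope st cf H0 fH.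
have [sx xt] : s <= x /\ x <= t by move: xI; rewrite in_itv/= => /andP[].
exists al, x; split=> //; first by rewrite al0.
move=> g m ac2f; rewrite square_integral//; first last.
- by move=> y; rewrite in_itv/= => /andP[sy yx]; apply: pos; rewrite in_itv/= sy (le_trans yx).
- exact: ac2_sub ac2f.
- exact: ltW.
rewrite alx fs atan0 addr0 S0 (E_split sx xt ac2f) -(height_integral _ (ltW st) cf fH).
rewrite (Rintegral_split sx xt); first by ring.
exact/continuous_integrable/continuous_height.
Qed.

(** The horizontal tangent is now at the right end, as for [- u'] on the left half. Only the
    inequality is kept on this side: an even function is determined by its right half. *)
Lemma energy_left f s t H : s < t -> continuous f -> f t = 0 -> 0 < H ->
  Rintegral mu `[s, t] f = - H ->
  exists2 al, 0 < al < pi / 2 & forall g m, ac2 f g s t ->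
    2 * m * S al - m ^+ 2 * ((t - s) * sin al - H * cos al) <= E f g s t.
Proof.
move=> st cf ft H0 fH.
have [al [x [/andP[al0 alp] xI alx pos]]] := tan_max_slope st cf H0 fH.
have [sx xt] : s <= x /\ x <= t by move: xI; rewrite in_itv/= => /andP[].
exists al => [|g m ac2f]; first by rewrite al0.
have : 0 <= Rintegral mu `[x, t] (fun y => (a (f y) * g y + (- m) * b al (f y)) ^+ 2).
  by apply: Rintegral_ge0 => y _; exact: sqr_ge0.
rewrite square_integral//; first last.
- by move=> y; rewrite in_itv/= => /andP[xy yt]; apply: pos; rewrite in_itv/= yt (le_trans sx).
- exact: ac2_sub ac2f.
- exact: ltW.
rewrite alx ft atan0 addr0 S0 subr0 sqrrN (E_split sx xt ac2f).
rewrite -(height_integral _ (ltW st) cf fH) (@Rintegral_split _ _ s x t sx xt); last first.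
  exact/continuous_integrable/continuous_height.
have := E_ge0 f g s x.
have : 0 <= m ^+ 2 * Rintegral mu `[s, x] (fun y => sin al + f y * cos al).
  rewrite mulr_ge0 ?sqr_ge0//; apply: Rintegral_ge0 => y /=; rewrite in_itv/=.
  by move=> /andP[sy yx]; apply: pos; rewrite in_itv/= sy (le_trans yx).
set I1 := (X in m ^+ 2 * (X + _)); set I2 := (X in m ^+ 2 * (_ + X)).
set E1 := E _ _ s x; set E2 := E _ _ x t; set s0 := S al => h1 h2 h3.
have -> : 2 * m * s0 - m ^+ 2 * (I1 + I2) =
  E2 - (E2 + 2 * - m * s0 + m ^+ 2 * I2) - m ^+ 2 * I1 by ring.
move: (m ^+ 2 * I1) (E2 + 2 * - m * s0 + m ^+ 2 * I2) h1 h3 => u v; lra.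
Qed.

End energy_bounds.

(** * The optimal turning angle *)

Section optimal_angle.
Variable R : realType.
Implicit Types (x y al be h m : R).

(* Up to a common factor, [D al] and [N al] are the width and the height of the
   arc of the free elastica from its inflection point to the point where it
   has turned by [al], in the frame where the latter has horizontal tangent. *)
Definition D al : R := 2 * rtsin al * cos al + sin al * S al.
Definition N al : R := 2 * rtsin al * sin al - cos al * S al.

Lemma cos_gt0_ph x : 0 < x < pi / 2 -> 0 < cos x :> R.
Proof. by move=> /andP[x0 xp]; apply: cos_gt0_pihalf; rewrite xp andbT; lra. Qed.

Lemma S_gt0_ph x : 0 < x < pi / 2 -> 0 < S x.
Proof. by move=> /andP[x0 xp]; apply: S_gt0; rewrite x0 ltW. Qed.

Lemma sin2cos2_1 x : sin x ^+ 2 + cos x ^+ 2 = 1 :> R.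
Proof. by rewrite addrC cos2Dsin2. Qed.

Lemma D_gt0 al : 0 < al < pi / 2 -> 0 < D al.
Proof.
move=> aI; have := sin_gt0_pihalf aI; have := cos_gt0_ph aI; have := S_gt0_ph aI.
move=> S0 c0 s0; have r0 := rtsin_gt0 s0.
by rewrite addr_gt0// ?mulr_gt0.
Qed.

(** The vector [(D al, N al)] is [(2 * rtsin al, - S al)] rotated by [al]. With curvature [rtsin] at
    angle [x] from the inflection tangent, [cos / rtsin] and [sin / rtsin] integrate to [2 * rtsin]
    and [S]. *)
Lemma sinD_cosN al : sin al * D al - cos al * N al = S al.
Proof. by have := sin2cos2_1 al; rewrite /D /N => H; rewrite -[RHS]mul1r -H; ring. Qed.

Lemma cosD_sinN al : cos al * D al + sin al * N al = 2 * rtsin al.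
Proof. by have := sin2cos2_1 al; rewrite /D /N => H; rewrite -[RHS]mulr1 -H; ring. Qed.

Lemma is_derive_SD x : 0 < x < pi / 2 ->
  is_derive x 1 (fun x => S x * D x)
    (2 * sin x * cos x + S x * cos x ^+ 2 / rtsin x + S x ^+ 2 * cos x).
Proof.
move=> xI; have s0 := sin_gt0_pihalf xI; have r0 := rtsin_gt0 s0.
have x4 : -4 < x by case/andP: xI => x0 _; lra.
have dS := is_derive_S x4; have dr := is_derive_rtsin s0.
rewrite /D; apply: is_derive_eq; rewrite /GRing.scale/=.
rewrite -(sqr_rtsin (ltW s0)); field; by rewrite gt_eqF.
Qed.

Lemma continuous_D x : -4 < x -> {for x, continuous D}.
Proof.
move=> x4; have cS := continuous_S x4; have cr := @continuous_rtsin R x.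
apply: cvgD; apply: cvgM => //; last exact: continuous_sin.
  by apply: cvgM => //; exact: cvg_cst.
exact: continuous_cos.
Qed.

Lemma continuous_N x : -4 < x -> {for x, continuous N}.
Proof.
move=> x4; have cS := continuous_S x4; have cr := @continuous_rtsin R x.
apply: cvgB; apply: cvgM => //; last exact: continuous_cos.
  by apply: cvgM => //; exact: cvg_cst.
exact: continuous_sin.
Qed.

(** [S * D] has a nonnegative derivative and equals [c_star ^+ 2] at [pi / 2]. Thus every arc
    turning by less than a right angle, scaled to unit width, costs at most [c_star ^+ 2]. *)
Lemma SD_le al : 0 < al < pi / 2 -> S al * D al <= c_star R ^+ 2.
Proof.
move=> /andP[al0 alp].
have dSD x : x \in `]al, (pi / 2)[ -> is_derive x 1 (fun x => S x * D x)
    (2 * sin x * cos x + S x * cos x ^+ 2 / rtsin x + S x ^+ 2 * cos x).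
  rewrite in_itv/= => /andP[ax xp]; apply: is_derive_SD.
  by rewrite xp andbT (lt_trans al0).
have cSD : {within `[al, pi / 2], continuous (fun x => S x * D x)}.
  apply: continuous_in_subspaceT => x; rewrite inE/= in_itv/= => /andP[ax _].
  have x4 : -4 < x by lra.
  by apply: cvgM; [exact: continuous_S|exact: continuous_D].
have [x] := MVT alp dSD cSD.
rewrite in_itv/= => /andP[ax xp].
have xI : 0 < x < pi / 2 by rewrite xp andbT (lt_trans al0).
have s0 := sin_gt0_pihalf xI; have c0 := cos_gt0_ph xI; have S0 := S_gt0_ph xI.
have r0 := rtsin_gt0 s0.
have -> : c_star R ^+ 2 = S (pi / 2) * D (pi / 2).
  by rewrite /D rtsin_pihalf sin_pihalf cos_pihalf mulr0 add0r mul1r c_starE -expr2.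
rewrite -subr_ge0 => ->; rewrite mulr_ge0 ?subr_ge0 ?(ltW alp)//.
by rewrite !addr_ge0// ?mulr_ge0 ?invr_ge0 ?sqr_ge0 ?(ltW s0) ?(ltW c0) ?(ltW S0) ?(ltW r0)//.
Qed.

(** The arc must have height-to-width ratio [h]. At [pi / 2] the function [N - h * D] is
    [2 - h * c_star], which is where the threshold [h_star] comes from; at [atan h] the terms in
    [rtsin] cancel and a negative value remains. *)
Lemma exists_optimal_angle h : 0 < h < h_star R ->
  exists2 al, 0 < al < pi / 2 & N al = h * D al.
Proof.
move=> /andP[h0 hh]; pose al0 := atan h.
have a00 : 0 < al0 by rewrite -(@atan0 R); exact: lt_atan.
have a0p : al0 < pi / 2 := atan_ltpi2 h.
have aI : 0 < al0 < pi / 2 by rewrite a00.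
have s0 := sin_gt0_pihalf aI; have k0 := cos_gt0_ph aI; have S0 := S_gt0_ph aI.
have c0 : 0 < c_star R by apply: lt_le_trans (c_star_ge1 R).
pose f x := N x - h * D x.
have fneg : f al0 < 0.
  have sE : sin al0 = h * cos al0 by rewrite /al0 sin_atanE.
  have -> : f al0 = - (S al0 * (cos al0 + h * sin al0)).
    by rewrite /f /N /D sE; ring.
  by rewrite oppr_lt0 mulr_gt0// addr_gt0// mulr_gt0.
have fpos : 0 < f (pi / 2).
  rewrite /f /N /D rtsin_pihalf sin_pihalf cos_pihalf -c_starE.
  move: hh; rewrite /h_star ltr_pdivlMr//; lra.
have cf : {within `[al0, pi / 2], continuous f}.
  apply: continuous_in_subspaceT => x; rewrite inE/= in_itv/= => /andP[ax _].
  have x4 : -4 < x by lra.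
  apply: cvgB; first exact: continuous_N.
  by apply: cvgM; [exact: cvg_cst|exact: continuous_D].
have [|al] := @IVT R f al0 (pi / 2) 0 (ltW a0p) cf.
  by rewrite ge_min le_max (ltW fneg) (ltW fpos) orbT.
rewrite in_itv/= => /andP[ge_al le_al] fal.
exists al; last by apply/eqP; rewrite -subr_eq0 -/(f al) fal.
rewrite (lt_le_trans a00)//= lt_neqAle le_al andbT.
by apply: contraTneq fpos => <-; rewrite fal ltxx.
Qed.

(** The multiplier [m] for which [x] is a critical point of [W h m]. *)
Let rho h x : R := 2 * rtsin x / (cos x + h * sin x).

Lemma rho_lt h x y : 0 < h <= 2 -> 0 < x -> x < y -> y < pi / 2 -> rho h x < rho h y.
Proof.
move=> /andP[h0 h2] x0 xy yp.
pose rho' z := (cos z ^+ 2 + 2 * sin z ^+ 2 - h * sin z * cos z) /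
  (rtsin z * (cos z + h * sin z) ^+ 2).
have zI z : x <= z -> z <= y -> 0 < z < pi / 2.
  by move=> xz zy; rewrite (lt_le_trans x0)//= (le_lt_trans zy).
have dr z : z \in `[x, y] -> is_derive z 1 (rho h) (rho' z).
  rewrite in_itv/= => /andP[xz zy]; have {}zI := zI z xz zy.
  have s0 := sin_gt0_pihalf zI; have k0 := cos_gt0_ph zI; have r0 := rtsin_gt0 s0.
  have d0 : cos z + h * sin z != 0 by rewrite gt_eqF// addr_gt0// mulr_gt0.
  have drt := is_derive_rtsin s0.
  rewrite /rho; apply: is_derive_eq; rewrite /GRing.scale/= /rho'.
  move: d0; rewrite -(sqr_rtsin (ltW s0)) => d0.
  by field; rewrite (gt_eqF r0) d0.
have dr' z : z \in `]x, y[ -> is_derive z 1 (rho h) (rho' z).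
  by move=> zxy; apply: dr; exact: (subset_itv_oo_cc zxy).
have [z] := MVT xy dr' (derive_within_continuous dr).
rewrite in_itv/= => /andP[xz zy].
have {}zI := zI z (ltW xz) (ltW zy).
have s0 := sin_gt0_pihalf zI; have k0 := cos_gt0_ph zI; have r0 := rtsin_gt0 s0.
rewrite -subr_gt0 => ->; rewrite mulr_gt0 ?subr_gt0// divr_gt0//; last first.
  by rewrite mulr_gt0// exprn_gt0// addr_gt0// mulr_gt0.
(* For [h <= 2] the numerator of [rho'] is at least [(cos z - sin z)^2 + sin z ^ 2]. *)
have : h * (sin z * cos z) <= 2 * (sin z * cos z).
  by rewrite ler_wpM2r// mulr_ge0// ltW.
have : 0 < sin z ^+ 2 by rewrite exprn_gt0.
have := sqr_ge0 (cos z - sin z); nra.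
Qed.

(** The lower bound for the energy of one half: unit width, height [h], steepest descent angle [x],
    multiplier [m]. *)
Definition W h m x : R := 2 * m * S x - m ^+ 2 * (sin x - h * cos x).

Lemma W_optimal h al : N al = h * D al -> W h (D al) al = S al * D al.
Proof.
move=> NhD; rewrite /W.
have -> : D al ^+ 2 * (sin al - h * cos al) =
  D al * (sin al * D al - cos al * (h * D al)) by ring.
by rewrite -NhD sinD_cosN; ring.
Qed.

(** The multiplier stays frozen at [D al] for all competing angles. The derivative in the angle has
    the sign of [rho h x - D al]; as [rho] is increasing and [rho h al = D al], it changes sign
    exactly once, at [al]. *)
Lemma W_min h al be : 0 < h <= 2 -> 0 < al < pi / 2 -> N al = h * D al ->
  0 < be < pi / 2 -> be != al -> W h (D al) al < W h (D al) be.
Proof.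
move=> hI aI NhD bI neq; set m := D al; have m0 : 0 < m := D_gt0 aI.
have [h0 h2] := andP hI.
have pos x : 0 < x < pi / 2 -> 0 < cos x + h * sin x.
  by move=> xI; rewrite addr_gt0 ?mulr_gt0 ?sin_gt0_pihalf ?cos_gt0_ph.
have rho_al : rho h al = m.
  rewrite /rho -cosD_sinN NhD -/m; field.
  by rewrite gt_eqF// pos.
pose W' x := m * (cos x + h * sin x) * (rho h x - m).
have dW x : 0 < x < pi / 2 -> is_derive x 1 (W h m) (W' x).
  move=> xI; have x4 : -4 < x by case/andP: xI => x0 _; lra.
  have dS := is_derive_S x4.
  rewrite /W; apply: is_derive_eq; rewrite /GRing.scale/= /W' /rho.
  by field; rewrite gt_eqF// pos.
have MW x y : 0 < x -> x < y -> y < pi / 2 ->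
    exists2 z, x < z < y & W h m y - W h m x = W' z * (y - x).
  move=> x0 xy yp.
  have dc z : z \in `[x, y] -> is_derive z 1 (W h m) (W' z).
    rewrite in_itv/= => /andP[xz zy]; apply: dW.
    by rewrite (lt_le_trans x0)//= (le_lt_trans zy).
  have doo z : z \in `]x, y[ -> is_derive z 1 (W h m) (W' z).
    by move=> zI; apply: dc; exact: (subset_itv_oo_cc zI).
  have [z] := MVT xy doo (derive_within_continuous dc).
  by rewrite in_itv/= => zI H; exists z.
have [a0 ap] := andP aI; have [b0 bp] := andP bI.
move: neq; rewrite neq_lt => /orP[ba|ab].
  have [z /andP[bz za] E] := MW be al b0 ba ap.
  have zI : 0 < z < pi / 2 by rewrite (lt_trans b0)//= (lt_trans za).
  rewrite -subr_lt0 E nmulr_rlt0 ?subr_gt0// /W' pmulr_rlt0 ?mulr_gt0 ?pos//.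
  by rewrite subr_lt0 -rho_al rho_lt//; case/andP: zI.
have [z /andP[az zb] E] := MW al be a0 ab bp.
have zI : 0 < z < pi / 2 by rewrite (lt_trans a0)//= (lt_trans zb).
rewrite -subr_gt0 E mulr_gt0 ?subr_gt0// /W' mulr_gt0 ?mulr_gt0 ?pos//.
by rewrite subr_gt0 -rho_al rho_lt//; case/andP: zI.
Qed.

Lemma h_star_le2 : h_star R <= 2.
Proof.
by rewrite /h_star ler_pdivrMr ?ler_peMr ?c_star_ge1// (lt_le_trans _ (c_star_ge1 R)).
Qed.

End optimal_angle.

(** * Representatives of a function in W22 *)

Section representatives.
Variable R : realType.
Local Notation mu := (@lebesgue_measure R).
Implicit Types (u f g du ddu : R -> R) (x y e L M : R).

Definition W22_data u f g := ac2 f g (-1) 1 /\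
  forall x y, -1 <= x -> x <= y -> y <= 1 -> u y - u x = Rintegral mu `[x, y] f.

Lemma weighted_integrandE du ddu :
  (fun x => (ddu x ^+ 2 * (1 + du x ^+ 2) `^ (- (5%:R / 2)))%:E) =
  (fun x => (k (du x) ^+ 5 * ddu x ^+ 2)%:E).
Proof. by apply/funext => x; rewrite weightE mulrC. Qed.

Lemma Bcurv_E du ddu f : ac2 f ddu (-1) 1 ->
  (forall x, x \in `[(-1 : R), 1] -> f x = du x) ->
  Bcurv du ddu = (E f ddu (-1) 1)%:E.
Proof.
move=> ac2f fdu; rewrite /E /Rintegral fineK; last first.
  exact/integrable_fin_num/integrable_E.
rewrite /Bcurv weighted_integrandE; apply: eq_integral => x; rewrite inE/= => xI.
by rewrite fdu.
Qed.

Lemma W22_rep_data u du ddu : W22_rep u du ddu ->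
  exists2 f, W22_data u f ddu & Bcurv du ddu = (E f ddu (-1) 1)%:E.
Proof.
move=> [mddu [ig [ig2 [rep1 rep2]]]].
(* [du] is arbitrary outside [[-1, 1]]; precomposing the primitive of [ddu] with the clipping map
   makes the slope continuous on the whole line. *)
pose clip x : R := Num.max (-1) (Num.min x 1).
have clip_in x : clip x \in `[-1, 1].
  by rewrite in_itv/= le_max lexx/= ge_max ge_min lexx orbT andbT; lra.
have clipE x : x \in `[-1, 1] -> clip x = x.
  by rewrite in_itv/= => /andP[x1 x2]; rewrite /clip min_l// max_r.
pose F x := du (-1) + Rintegral mu `[-1, x] ddu.
have cF : {within `[-1, 1], continuous F}.
  have N11 : -1 <= 1 :> R by lra.
  have cI := parameterized_integral_continuous N11 ig.
  by move=> x; apply: cvgD; [exact: cvg_cst|exact: cI].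
pose f x := F (clip x).
have cclip : continuous clip.
  move=> x; have cid : {for x, continuous (fun y : R => y)} by exact: cvg_id.
  have ccst (c : R) : {for x, continuous (fun _ : R => c)} by exact: cvg_cst.
  exact: (continuous_max (ccst (-1)) (continuous_min cid (ccst 1))).
have cf : continuous f.
  move=> x; have /subspace_continuousP/(_ (clip x) (clip_in x)) Fx := cF.
  have clipx : clip z @[z --> x] --> within `[-1, 1] (nbhs (clip x)).
    move=> P HP; have := cclip x _ HP.
    by apply: (@filterS _ (nbhs x)) => z; apply; exact: clip_in.
  exact: cvg_comp clipx Fx.
have fdu x : x \in `[-1, 1] -> f x = du x.
  by move=> xI; rewrite /f clipE// /F -rep1.
have N1 : -1 \in `[(-1 : R), 1] by rewrite in_itv/=; lra.
have incr phi F0 : mu.-integrable `[-1, 1] (EFin \o phi) ->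
    (forall x, x \in `[-1, 1] -> F0 x = F0 (-1) + Rintegral mu `[-1, x] phi) ->
    forall x y, -1 <= x -> x <= y -> y <= 1 -> F0 y - F0 x = Rintegral mu `[x, y] phi.
  move=> iphi H x y x1 xy y1.
  rewrite (H x) ?in_itv/= ?x1 ?(le_trans xy)// (H y) ?in_itv/= ?y1 ?(le_trans x1)//.
  rewrite (@Rintegral_split _ _ (-1) x y)//; first by ring.
  exact: integrable_sub iphi.
have acf : ac2 f ddu (-1) 1.
  split; last exact: ig2; split=> //; apply: incr => // x xI.
  by rewrite !fdu// rep1.
exists f; last exact: (Bcurv_E acf fdu).
split=> //; apply: incr => [|x xI]; first exact: continuous_integrable.
rewrite rep2//; congr (_ + _); apply: eq_Rintegral => z; rewrite inE/= in_itv/=.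
move=> /andP[z1 zx]; apply/esym/fdu; rewrite in_itv/= z1 (le_trans zx)//.
by move: xI; rewrite in_itv/= => /andP[].
Qed.

Lemma data_derive u f g x : W22_data u f g -> -1 < x < 1 -> is_derive x 1 u (f x).
Proof.
move=> [[[cf _ _] _] uf] /andP[x1 x2].
have dI := is_derive_Rintegral x1 cf.
have dc : is_derive x 1 (fun y => u (-1) + Rintegral mu `[-1, y] f) (f x).
  by rewrite -[f x]add0r; exact: is_deriveD.
have xI : x \in `](-1), 1[ by rewrite in_itv/= x1 x2.
apply: near_eq_is_derive dc; apply: filterS (near_in_itvoo xI) => y.
by rewrite in_itv/= => /andP[y1 y2]; rewrite -(uf (-1) y (lexx _) (ltW y1) (ltW y2)) addrC subrK.
Qed.

Lemma data_unique u f1 g1 f2 g2 : W22_data u f1 g1 -> W22_data u f2 g2 ->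
  forall x, x \in `[-1, 1] -> f1 x = f2 x.
Proof.
move=> d1 d2.
have oo x : -1 < x < 1 -> f1 x = f2 x.
  move=> xI; have [_ <-] := data_derive d1 xI.
  by have [_ <-] := data_derive d2 xI.
have [[[cf1 _ _] _] _] := d1; have [[[cf2 _ _] _] _] := d2.
move=> x xI; apply/eqP; rewrite -subr_eq0; apply/eqP.
have ch : {for x, continuous (fun y => f1 y - f2 y)}.
  by apply: cvgB; [exact: cf1|exact: cf2].
apply/eqP; rewrite -normr_le0; apply/ler_addgt0Pr => e e0; rewrite add0r.
move/cvgrPdist_lt : ch => /(_ e e0) /nbhs_ballP[d /= d0 Hd].
(* Shrinking [x] towards 0 by less than [d] lands in the open interval, where both slopes are the
   derivative of [u]. *)
pose y : R := x * (1 - Num.min d 1 / 2).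
have m0 : 0 < Num.min d 1 by rewrite lt_min d0 ltr01.
have m1 : Num.min d 1 <= 1 by rewrite ge_min lexx orbT.
have md : Num.min d 1 <= d by rewrite ge_min lexx.
move: xI; rewrite in_itv/= => /andP[x1 x2].
have yI : -1 < y < 1.
  by rewrite /y; apply/andP; split; nra.
have fy : f1 y - f2 y = 0 by rewrite oo// subrr.
have := Hd y; rewrite /ball/= fy subr0 => H; apply/ltW/H.
rewrite /y ltr_norml; apply/andP; split; nra.
Qed.

(** Any representative can be evaluated with the fixed slope [f] in place of its own [du]. This
    reduces [B u] to an infimum over second derivatives alone. *)
Lemma data_W22_rep u f g du ddu : W22_data u f g -> W22_rep u du ddu ->
  W22_data u f ddu /\ Bcurv du ddu = (E f ddu (-1) 1)%:E.
Proof.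
move=> dg /W22_rep_data[f' df' ->].
have ff := data_unique df' dg.
have [[[cf _ _] _] uf] := dg; have [[[cf' ig ff'] ig2] _] := df'.
split; last first.
  congr EFin; apply: eq_Rintegral => x; rewrite inE/= => xI.
  by rewrite ff.
split=> //; split=> //; split=> // x y x1 xy y1.
by rewrite -ff' ?ff// in_itv/= ?x1 ?y1/= ?(le_trans xy)// (le_trans x1).
Qed.

Lemma B_ge u f g L : W22_data u f g ->
  (forall g', W22_data u f g' -> L <= E f g' (-1) 1) -> (L%:E <= B u)%E.
Proof.
move=> dg H; apply: le_ereal_inf_tmp => _ [du [ddu [rep ->]]].
by have [d' ->] := data_W22_rep dg rep; rewrite lee_fin; exact: H.
Qed.

Lemma B_approx u f g M e : W22_data u f g -> (B u <= M%:E)%E -> 0 < e ->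
  exists2 g', W22_data u f g' & E f g' (-1) 1 < M + e.
Proof.
move=> dg BM e0; have : (B u < (M + e)%:E)%E.
  by apply: le_lt_trans BM _; rewrite lte_fin ltrDl.
move=> /ereal_inf_lt[_ [du [ddu [rep ->]]]].
by have [d' ->] := data_W22_rep dg rep; rewrite lte_fin; exists ddu.
Qed.

Lemma smooth_W22_rep u f g : continuous g ->
  (forall x, x \in `[-1, 1] -> is_derive x 1 f (g x)) ->
  continuous f -> (forall x, x \in `[-1, 1] -> is_derive x 1 u (f x)) ->
  W22_rep u f g /\ W22_data u f g.
Proof.
move=> cg df cf du.
have FTC (F' F : R -> R) : continuous F' ->
    (forall x, x \in `[-1, 1] -> is_derive x 1 F (F' x)) ->
    forall x y, -1 <= x -> x <= y -> y <= 1 -> F y - F x = Rintegral mu `[x, y] F'.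
  move=> cF' dF x y x1 xy y1.
  have dF' z : z \in `[x, y] -> is_derive z 1 F (F' z).
    rewrite in_itv/= => /andP[xz zy]; apply: dF.
    by rewrite in_itv/= (le_trans x1 xz) (le_trans zy y1).
  exact: esym (@Rintegral_FTC2_cc R F' F x y xy cF' dF').
have cg2 : continuous (fun x => g x ^+ 2).
  by move=> x; exact: (cvgM (cg x) (cg x)).
have ig := continuous_integrable (-1) 1 cg.
have ig2 := continuous_integrable (-1) 1 cg2.
have FTC' F' F : continuous F' ->
    (forall x, x \in `[-1, 1] -> is_derive x 1 F (F' x)) ->
    forall x, x \in `[(-1 : R), 1] -> F x = F (-1) + Rintegral mu `[-1, x] F'.
  move=> cF' dF x; rewrite in_itv/= => /andP[x1 x2].
  by rewrite -(FTC F' F)//; ring.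
split; last first.
  by split; [split=> //; split=> //; exact: FTC|exact: FTC].
split; first by apply: measurable_funTS; exact: continuous_measurable_fun.
by split=> //; split=> //; split; exact: FTC'.
Qed.

End representatives.

(** * Lower bounds *)

Section lower_bounds.
Variable R : realType.
Local Notation mu := (@lebesgue_measure R).
Local Notation c := (c_star R).
Implicit Types (u f g : R -> R) (x y al h m H e : R).

Lemma c_star_gt0 : 0 < c.
Proof. exact: lt_le_trans (c_star_ge1 R). Qed.

Lemma RintegralN f x y : continuous f ->
  Rintegral mu `[x, y] (fun z => - f z) = - Rintegral mu `[x, y] f.
Proof.
move=> cf; rewrite -mulN1r -RintegralZl//; last exact: continuous_integrable.
by apply: eq_Rintegral => z _; rewrite mulN1r.
Qed.

(** With the multiplier [c / rtsin al], [S_lower] leaves the surplus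
    [(c * H - 2) * c * cos al / sin al], nonnegative exactly because [H >= h_star]. The bound is
    affine in the width [l], so the bounds on the two sides of a maximum point add up to a
    constant. *)
Lemma side_bound al l H : 0 < al < pi / 2 -> h_star R <= H ->
  c ^+ 2 * (2 - l) <
  2 * (c / rtsin al) * S al - (c / rtsin al) ^+ 2 * (l * sin al - H * cos al).
Proof.
move=> aI hH; have s0 := sin_gt0_pihalf aI; have k0 := cos_gt0_ph aI.
have r0 := rtsin_gt0 s0; have c0 := c_star_gt0.
have rn : rtsin al != 0 by rewrite gt_eqF.
have cH : 2 <= c * H by rewrite mulrC -ler_pdivrMr.
have := S_lower aI; rewrite -(sqr_rtsin (ltW s0)) => HS.
have E1 : 2 * (c / rtsin al) * (c * rtsin al - cos al / rtsin al) <
    2 * (c / rtsin al) * S al by rewrite ltr_pM2l// mulr_gt0// divr_gt0.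
have E2 : 0 <= (c * H - 2) * (c * cos al / rtsin al ^+ 2).
  by rewrite mulr_ge0 ?subr_ge0// divr_ge0 ?mulr_ge0 ?sqr_ge0 ?ltW.
have E3 : 2 * (c / rtsin al) * (c * rtsin al - cos al / rtsin al) -
    (c / rtsin al) ^+ 2 * (l * rtsin al ^+ 2 - H * cos al) =
  c ^+ 2 * (2 - l) + (c * H - 2) * (c * cos al / rtsin al ^+ 2) by field.
by rewrite -(ltrD2r (- ((c / rtsin al) ^+ 2 * (l * rtsin al ^+ 2 - H * cos al)))) E3 in E1;
  apply: le_lt_trans E1; rewrite lerDl.
Qed.

Lemma data_right u f g x : W22_data u f g -> -1 < x -> x < 1 -> u 1 = 0 ->
  Rintegral mu `[x, 1] f = - u x.
Proof. by move=> [_ uf] x1 x2 u1; rewrite -(uf x 1 (ltW x1) (ltW x2) (lexx _)) u1 sub0r. Qed.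

Lemma data_left u f g x : W22_data u f g -> -1 < x -> x < 1 -> u (-1) = 0 ->
  Rintegral mu `[-1, x] (fun z => - f z) = - u x.
Proof.
move=> [[[cf _ _] _] uf] x1 x2 u1.
by rewrite RintegralN// -(uf _ _ (lexx _) (ltW x1) (ltW x2)) u1 subr0.
Qed.

Lemma two_sided_energy u f g x : W22_data u f g -> -1 < x -> x < 1 ->
  u (-1) = 0 -> u 1 = 0 -> f x = 0 -> 0 < u x ->
  exists al be, [/\ 0 < al < pi / 2, 0 < be < pi / 2 &
    forall g' m n, W22_data u f g' ->
      (2 * m * S al - m ^+ 2 * ((1 - x) * sin al - u x * cos al)) +
      (2 * n * S be - n ^+ 2 * ((x + 1) * sin be - u x * cos be)) <=
      E f g' (-1) 1].
Proof.
move=> dg x1 x2 uN1 u1 fx ux; have [[[cf _ _] _] _] := dg.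
have cNf : continuous (fun z => - f z) by move=> z; apply: cvgN; exact: cf.
have [al [y [aI yI _ pos rightE]]] :=
  energy_right x2 cf fx ux (data_right dg x1 x2 u1).
have Nfx : - f x = 0 by rewrite fx oppr0.
have [be bI leftE] := energy_left x1 cNf Nfx ux (data_left dg x1 x2 uN1).
exists al, be; split=> // g' m n [ac2f _].
have acl : ac2 f g' (-1) x by apply: ac2_sub ac2f => //; exact: ltW.
have acr : ac2 f g' x 1 by apply: ac2_sub ac2f => //; exact: ltW.
have := leftE _ n (ac2N acl); rewrite EN opprK => Hl.
have := rightE g' m acr => Hr.
rewrite (E_split (ltW x1) (ltW x2) ac2f) addrC lerD//.
rewrite -subr_ge0 (_ : _ - _ = E f g' x 1 - 2 * m * S al +
  m ^+ 2 * ((1 - x) * sin al - u x * cos al)); last by ring.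
rewrite -Hr.
have [xy y1] : x <= y /\ y <= 1 by move: yI; rewrite in_itv/= => /andP[].
rewrite !addr_ge0 ?E_ge0//.
  by apply: Rintegral_ge0 => z _; exact: sqr_ge0.
rewrite mulr_ge0 ?sqr_ge0//; apply: Rintegral_ge0 => z /=; rewrite in_itv/=.
by move=> /andP[yz z1]; apply: pos; rewrite in_itv/= z1 (le_trans xy).
Qed.

Lemma data_max u f g : W22_data u f g -> u (-1) = 0 -> u 1 = 0 -> 0 < u 0 ->
  exists x, [/\ -1 < x, x < 1, f x = 0 & u 0 <= u x].
Proof.
move=> dg uN1 u1 u0; have [[[cf _ _] _] uf] := dg.
(* The base point -2 makes [U] differentiable at the endpoint -1 as well. *)
pose U y := Rintegral mu `[-2, y] f - Rintegral mu `[-2, -1] f.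
have dU y : y \in `[-1, 1] -> is_derive y 1 U (f y).
  rewrite in_itv/= => /andP[y1 _]; rewrite -[f y]subr0.
  have y2 : -2 < y by lra.
  by have := is_derive_Rintegral y2 cf => H; exact: is_deriveB.
have UE y : y \in `[-1, 1] -> U y = u y.
  rewrite in_itv/= => /andP[y1 y2]; rewrite /U (@Rintegral_split _ _ (-2) (-1) y)//.
  - by rewrite -(uf (-1) y (lexx _) y1 y2) uN1; ring.
  - by lra.
  - exact: continuous_integrable.
have NI : -1 \in `[(-1 : R), 1] by rewrite in_itv/=; lra.
have PI : 1 \in `[(-1 : R), 1] by rewrite in_itv/=; lra.
have OI : 0 \in `[(-1 : R), 1] by rewrite in_itv/=; lra.
have le11 : -1 <= 1 :> R by lra.
have [x xI Ux] := EVT_max le11 (derive_within_continuous dU).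
have ux : u 0 <= u x by have := Ux 0 OI; rewrite !UE.
have xN1 : x != -1 by apply: contraTneq ux => ->; rewrite uN1 -ltNge.
have x1 : x != 1 by apply: contraTneq ux => ->; rewrite u1 -ltNge.
have xoo : x \in `](-1), 1[.
  by move: xI; rewrite !in_itv/= !le_eqVlt (negbTE x1) eq_sym (negbTE xN1).
have ooc y : y \in `](-1), 1[ -> y \in `[(-1 : R), 1] by move=> /subset_itv_oo_cc.
have dU' y : y \in `](-1), 1[ -> derivable U y 1.
  by move=> yI; have [] := dU y (ooc y yI).
have [_ U0] := derive1_at_max le11 dU' xoo (fun y yI => Ux y (ooc y yI)).
have [_ Uf] := dU x xI.
exists x; split=> //; last by rewrite -Uf U0.
- by move: xoo; rewrite in_itv/= => /andP[].
- by move: xoo; rewrite in_itv/= => /andP[].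
Qed.

(** Jensen's inequality on an interval of length at most 1. It passes from small integrals of
    squares to small increments in the equality case. *)
Lemma sqr_Rintegral_le w x y : x <= y -> y <= x + 1 ->
  mu.-integrable `[x, y] (EFin \o w) ->
  mu.-integrable `[x, y] (EFin \o (fun z => w z ^+ 2)) ->
  Rintegral mu `[x, y] w ^+ 2 <= Rintegral mu `[x, y] (fun z => w z ^+ 2).
Proof.
move=> xy yx iw iw2; set I := Rintegral mu `[x, y] w.
have : 0 <= Rintegral mu `[x, y] (fun z => (w z - I) ^+ 2).
  by apply: Rintegral_ge0 => z _; exact: sqr_ge0.
have icst (d : R) : mu.-integrable `[x, y] (EFin \o (fun=> d)).
  by apply: continuous_integrable => z; exact: cvg_cst.
have iZ : mu.-integrable `[x, y] (EFin \o (fun z => - (2 * I) * w z)).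
  by apply: integrable_continuousM iw => z; exact: cvg_cst.
rewrite (@eq_Rintegral _ _ _ mu _ (fun z => (w z ^+ 2 + - (2 * I) * w z) + I ^+ 2)).
  rewrite RintegralD//; last exact: integrableDr.
  rewrite RintegralD// RintegralZl// -/I Rintegral_cst//= lebesgue_measure_itv/= lte_fin.
  have -> : fine (if x < y then (y%:E - x%:E)%E else 0) = y - x.
    by case: ltgtP xy => // -> _; rewrite subrr.
  move: (Rintegral _ _ (fun z => w z ^+ 2)) => J.
  have : 0 <= I ^+ 2 by exact: sqr_ge0.
  nra.
by move=> z _; ring.
Qed.

End lower_bounds.

(** * Uniqueness *)

Section uniqueness.
Variable R : realType.
Local Notation mu := (@lebesgue_measure R).
Implicit Types (u f g : R -> R) (x y s t al be h m H e : R).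

Lemma sqr_lt_eq0 x : (forall e, 0 < e -> x ^+ 2 < e) -> x = 0.
Proof.
move=> H; apply/eqP/negPn/negP => x0.
have x2 : 0 < x ^+ 2 by rewrite lt_neqAle sqr_ge0 eq_sym sqrf_eq0 x0.
by have := H _ x2; rewrite ltxx.
Qed.

(** At the angle [pi / 2] the factor [b] is 1, so [S (pi / 2 + atan d)] is a primitive of [a]. *)
Lemma turning_integral f g s t : s <= t -> ac f g s t ->
  S (pi / 2 + atan (f t)) - S (pi / 2 + atan (f s)) =
  Rintegral mu `[s, t] (fun z => a (f z) * g z).
Proof.
move=> st acf; have p0 : 0 <= pi / 2 :> R by rewrite divr_ge0// pi_ge0.
rewrite (ac_chain st acf (fun d => is_derive_Q d p0) (@continuous_ab R (pi / 2))).
by apply: eq_Rintegral => z _; rewrite b_pihalf mulr1.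
Qed.

Lemma integrable_af f g s t : ac f g s t ->
  mu.-integrable `[s, t] (EFin \o (fun z => a (f z) * g z)).
Proof.
move=> [cf ig _]; apply: integrable_continuousM => // z.
by apply: continuous_comp; [exact: cf|exact: continuous_a].
Qed.

Lemma continuous_bf al f : continuous f -> continuous (fun z => b al (f z)).
Proof. by move=> cf z; apply: continuous_comp; [exact: cf|exact: continuous_b]. Qed.

Lemma integrable_sqr_residual al m f g s t : ac2 f g s t ->
  mu.-integrable `[s, t] (EFin \o (fun z => (a (f z) * g z + m * b al (f z)) ^+ 2)).
Proof.
move=> ac2f; have [[cf ig ff] ig2] := ac2f; have cb := continuous_bf (al := al) cf.
have ca : continuous (fun z => a (f z)).
  by move=> z; apply: continuous_comp; [exact: cf|exact: continuous_a].
have c1 : continuous (fun z => 2 * m * b al (f z) * a (f z)).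
  by move=> z; apply: cvgM (ca z); apply: cvgM (cb z); exact: cvg_cst.
have c2 : continuous (fun z => m ^+ 2 * (b al (f z) * b al (f z))).
  by move=> z; apply: cvgM (cvgM (cb z) (cb z)); exact: cvg_cst.
have := integrableDr (integrableDr (integrable_E ac2f) (integrable_continuousM c1 ig))
  (continuous_integrable s t c2).
apply: eq_integrable => // z _ /=; congr EFin.
by rewrite -sqr_a; ring.
Qed.

(** The bound increases with the height because [cos be > 0], so [H] can be lowered to [h], where
    [W_min] applies. *)
Lemma side_energy_min al be h H : 0 < h <= 2 -> 0 < al < pi / 2 -> N al = h * D al ->
  0 < be < pi / 2 -> h <= H ->
  S al * D al <= 2 * D al * S be - D al ^+ 2 * (sin be - H * cos be) /\
  (be != al ->
    S al * D al < 2 * D al * S be - D al ^+ 2 * (sin be - H * cos be)).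
Proof.
move=> hI aI NhD bI hH; have m0 := D_gt0 aI.
have WH : W h (D al) be <= 2 * D al * S be - D al ^+ 2 * (sin be - H * cos be).
  rewrite /W lerD2l lerN2 ler_wpM2l ?sqr_ge0// lerD2l lerN2.
  by rewrite ler_wpM2r// ltW// cos_gt0_ph.
rewrite -(W_optimal NhD); split=> [|neq]; last first.
  exact: lt_le_trans (W_min hI aI NhD bI neq) WH.
apply: le_trans WH; have [->//|neq] := eqVneq be al.
exact/ltW/W_min.
Qed.

(** The near-minimal second derivatives change with [e], so the first order equation is stated in
    integrated form, which involves only [f]. *)
Lemma right_equation u f g al h : 0 < h <= 2 -> 0 < al < pi / 2 -> N al = h * D al ->
  W22_data u f g -> u (-1) = 0 -> u 1 = 0 -> f 0 = 0 -> h <= u 0 ->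
  (forall e, 0 < e -> exists2 g', W22_data u f g' &
     E f g' (-1) 1 < 2 * (S al * D al) + e) ->
  forall y, 0 <= y -> y <= 1 ->
    S (pi / 2 + atan (f y)) - S (pi / 2) +
    D al * Rintegral mu `[0, y] (fun z => b al (f z)) = 0.
Proof.
move=> hI aI NhD dg uN1 u1 f0 hu approx; set m := D al.
have [h0 h2] := andP hI; have m0 : 0 < m := D_gt0 aI.
have N10 : -1 < 0 :> R by lra.
have u0 : 0 < u 0 := lt_le_trans h0 hu.
have [[[cf _ _] _] _] := dg; have cb := continuous_bf (al := al) cf.
have cNf : continuous (fun z => - f z) by move=> z; apply: cvgN; exact: cf.
have Nf0 : - f 0 = 0 by rewrite f0 oppr0.
have [be2 b2I leftE] := energy_left N10 cNf Nf0 u0 (data_left dg N10 ltr01 uN1).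
have [be [x [bI xI _ pos rightE]]] :=
  energy_right ltr01 cf f0 u0 (data_right dg N10 ltr01 u1).
have [x0 x1] : 0 <= x /\ x <= 1 by move: xI; rewrite in_itv/= => /andP[].
rewrite subr0 sub0r opprK !mul1r in leftE rightE.
pose J := Rintegral mu `[x, 1] (fun z => sin be + f z * cos be).
have J0 : 0 <= J.
  apply: Rintegral_ge0 => z /=; rewrite in_itv/= => /andP[xz z1].
  by apply: pos; rewrite in_itv/= z1 (le_trans x0).
pose I g' := Rintegral mu `[0, x] (fun z => (a (f z) * g' z + m * b be (f z)) ^+ 2).
have I0 g' : 0 <= I g' by apply: Rintegral_ge0 => z _; exact: sqr_ge0.
(* The left half already costs at least [S al * D al]; subtracting this from the near-minimal total
   bounds the remainders of the right half. *)
have right_lt e : 0 < e -> exists2 g', ac2 f g' 0 1 &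
    I g' + (E f g' x 1 + m ^+ 2 * J) + (2 * m * S be - m ^+ 2 * (sin be - u 0 * cos be)) <
    S al * D al + e.
  move=> e0; have [g' [ac2f _] Elt] := approx e e0.
  have acl : ac2 f g' (-1) 0 := ac2_sub (lexx _) ler01 ac2f.
  have acr : ac2 f g' 0 1 := ac2_sub (ltW N10) (lexx _) ac2f.
  exists g' => //; have := leftE _ m (ac2N acl); rewrite EN => Hl.
  have [Hmin _] := side_energy_min hI aI NhD b2I hu.
  have Er := rightE g' m acr; rewrite -/J -/(I g') in Er; rewrite Er.
  move: Elt; rewrite (E_split (ltW N10) ler01 ac2f) => Elt.
  rewrite [ltLHS](_ : _ = E f g' 0 1); last by ring.
  have := le_trans Hmin Hl; move: Elt.
  clear; move: (S al * D al) (E f g' 0 1) (E f g' (-1) 0) => p q r; lra.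
(* Otherwise [e] can be the strict gap between the bounds for [be] and [al], and the nonnegative
   remainders would have a negative sum. *)
have beE : be = al.
  apply/eqP/negPn/negP => neq.
  have [_ /(_ neq)] := side_energy_min hI aI NhD bI hu; rewrite -subr_gt0 -/m => e0.
  have [g' _] := right_lt _ e0.
  have mJ : 0 <= m ^+ 2 * J by rewrite mulr_ge0 ?sqr_ge0.
  have := addr_ge0 (I0 g') (addr_ge0 (E_ge0 f g' x 1) mJ); clear.
  move: (_ + (_ + _)) (S al * D al) => p q; rewrite addrC; set r := (_ - _); lra.
have small e : 0 < e -> exists2 g', ac2 f g' 0 1 &
    [/\ I g' < e, E f g' x 1 < e & m ^+ 2 * J < e].
  move=> e0; have [g' acr Hlt] := right_lt _ e0; exists g' => //.
  have [+ _] := side_energy_min hI aI NhD bI hu; rewrite -[D al ^+ 2]/(m ^+ 2) => Hmin.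
  have mJ : 0 <= m ^+ 2 * J by rewrite mulr_ge0 ?sqr_ge0.
  have := I0 g'; have := E_ge0 f g' x 1; move: mJ Hmin Hlt; clear.
  move: (m ^+ 2 * J) (E f g' x 1) (I g') (S al * D al) => j E1 i1 p.
  by rewrite -/m; set r := (_ - _); split; lra.
have {}J0 : J = 0.
  have mJ : m ^+ 2 * J <= 0.
    by apply/ler_addgt0Pr => e e0; have [g' _ [_ _ /ltW]] := small e e0; rewrite add0r.
  by apply/eqP; rewrite eq_le J0 andbT; move: mJ; rewrite pmulr_rle0// exprn_gt0.
have at0 : pi / 2 + atan (f 0) = pi / 2 :> R by rewrite f0 atan0 addr0.
(* Up to the steepest point, the left-hand side is the integral of [a * g' + m * b], whose squared
   norm is a remainder below [e]. *)
have first y : 0 <= y -> y <= x -> S (pi / 2 + atan (f y)) - S (pi / 2) +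
    m * Rintegral mu `[0, y] (fun z => b al (f z)) = 0.
  move=> y0 yx; apply: sqr_lt_eq0 => e e0; have [g' acr [Ig _ _]] := small e e0.
  have acy : ac2 f g' 0 y by apply: ac2_sub acr => //; lra.
  have acx : ac2 f g' 0 x by apply: ac2_sub acr.
  have [acy1 _] := acy.
  have iw := integrable_sqr_residual be m acy; have iwx := integrable_sqr_residual be m acx.
  have ib := continuous_integrable 0 y cb.
  have imb : mu.-integrable `[0, y] (EFin \o (fun z => m * b al (f z))).
    by apply: integrable_continuousM ib => z; exact: cvg_cst.
  have ia := integrable_af acy1.
  rewrite -[X in _ - S X + _]at0 (turning_integral y0 acy1) -RintegralZl// -RintegralD//.
  apply: le_lt_trans Ig; rewrite -beE.
  apply: le_trans (sqr_Rintegral_le _ _ _ _) _ => //.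
  - by lra.
  - by rewrite beE; exact: integrableDr.
  - rewrite /I (Rintegral_split y0 yx iwx) lerDl.
    by apply: Rintegral_ge0 => z _; exact: sqr_ge0.
move=> y y0 y1; have [yx|/ltW xy] := leP y x; first exact: first.
(* Beyond the steepest point the curve is straight: its energy there is below every [e], and [J = 0]
   makes [b] integrate to 0. *)
have Fy : S (pi / 2 + atan (f y)) - S (pi / 2 + atan (f x)) = 0.
  apply: sqr_lt_eq0 => e e0; have [g' acr [_ Eg _]] := small e e0.
  have acy : ac2 f g' x y by exact: ac2_sub acr.
  have acx : ac2 f g' x 1 by exact: ac2_sub acr.
  have [acy1 _] := acy.
  rewrite (turning_integral xy acy1); apply: le_lt_trans Eg.
  have := sqr_Rintegral_le xy _ (integrable_af acy1).
  have E2 : (fun z => (a (f z) * g' z) ^+ 2) = (fun z => k (f z) ^+ 5 * g' z ^+ 2).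
    by apply/funext => z; rewrite -sqr_a; ring.
  rewrite E2 => H; rewrite (E_split xy y1 acx).
  apply: le_trans (H _ (integrable_E acy)) _; first by lra.
  by rewrite lerDl E_ge0.
have by0 : Rintegral mu `[x, y] (fun z => b al (f z)) = 0.
  apply/eqP; rewrite -sqrf_eq0 eq_le sqr_ge0 andbT -J0.
  have ib := continuous_integrable x y cb.
  have cb2 : continuous (fun z => b al (f z) ^+ 2).
    by move=> z; exact: (cvgM (cb z) (cb z)).
  have ih := continuous_integrable x 1 (continuous_height (al := be) cf).
  apply: le_trans (sqr_Rintegral_le xy _ ib (continuous_integrable x y cb2)) _.
    by lra.
  rewrite /J (Rintegral_split xy y1 ih) -[leLHS]addr0 lerD//.
    rewrite le_eqVlt; apply/orP; left; apply/eqP.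
    apply: eq_Rintegral => z; rewrite inE/= in_itv/= => /andP[xz zy].
    by rewrite beE sqr_b// -beE pos// in_itv/= (le_trans x0)//= (le_trans zy).
  apply: Rintegral_ge0 => z /=; rewrite in_itv/= => /andP[yz z1].
  by apply: pos; rewrite in_itv/= z1 (le_trans y0).
have ib := continuous_integrable 0 y cb.
rewrite (Rintegral_split x0 xy ib) by0 addr0.
by rewrite (subr0_eq Fy); exact: first.
Qed.

(* [b al] is increasing, so the squared difference of two solutions of
   (S (pi / 2 + atan f))' = - m * b al f is nonincreasing. *)
Lemma right_equation_unique al m f1 f2 : 0 < al < pi / 2 -> 0 < m ->
  continuous f1 -> continuous f2 ->
  (forall y, 0 <= y -> y <= 1 -> S (pi / 2 + atan (f1 y)) - S (pi / 2) +
    m * Rintegral mu `[0, y] (fun z => b al (f1 z)) = 0) ->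
  (forall y, 0 <= y -> y <= 1 -> S (pi / 2 + atan (f2 y)) - S (pi / 2) +
    m * Rintegral mu `[0, y] (fun z => b al (f2 z)) = 0) ->
  forall y, 0 <= y -> y <= 1 -> f1 y = f2 y.
Proof.
move=> aI m0 cf1 cf2 eq1 eq2.
have cb1 := continuous_bf (al := al) cf1; have cb2 := continuous_bf (al := al) cf2.
pose K i y := Rintegral mu `[-1, y] (fun z => b al (i z)) -
  Rintegral mu `[-1, 0] (fun z => b al (i z)).
have N10 : -1 <= 0 :> R by lra.
have KE i y : continuous i -> 0 <= y -> K i y = Rintegral mu `[0, y] (fun z => b al (i z)).
  move=> ci y0; rewrite /K (Rintegral_split N10 y0); first by ring.
  exact/continuous_integrable/continuous_bf.
have dK i y : continuous i -> 0 <= y -> is_derive y 1 (K i) (b al (i y)).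
  move=> ci y0; have y1 : -1 < y by lra.
  have := is_derive_Rintegral y1 (continuous_bf (al := al) ci) => H.
  by rewrite -[b al _]subr0; exact: is_deriveB.
pose Z y := (K f1 y - K f2 y) ^+ 2.
have sgn y : 0 <= y -> y <= 1 -> S (pi / 2 + atan (f1 y)) - S (pi / 2 + atan (f2 y)) =
    - m * (K f1 y - K f2 y).
  move=> y0 y1; rewrite !KE//; have := eq1 y y0 y1; have := eq2 y y0 y1; lra.
have mono d1 d2 : d1 <= d2 -> S (pi / 2 + atan d1) <= S (pi / 2 + atan d2) /\
    b al d1 <= b al d2.
  move=> d12; split.
    apply: S_le; last by rewrite lerD2l le_atan.
    by have := atan_gtNpi2 d1; lra.
  by apply: ler_wsqrtr; rewrite lerD2l ler_wpM2r// ltW// cos_gt0_ph.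
have dZ y : y \in `[0, 1] -> is_derive y 1 Z
    (2 * (K f1 y - K f2 y) * (b al (f1 y) - b al (f2 y))).
  rewrite in_itv/= => /andP[y0 y1].
  have d1 := dK f1 y cf1 y0; have d2 := dK f2 y cf2 y0.
  by rewrite /Z; apply: is_derive_eq; rewrite /GRing.scale/=; ring.
have Z0 y : 0 <= y -> y <= 1 -> Z y <= 0.
  move=> y0 y1.
  have dZ' z : z \in `[0, y] -> is_derive z 1 Z
      (2 * (K f1 z - K f2 z) * (b al (f1 z) - b al (f2 z))).
    rewrite in_itv/= => /andP[z0 zy]; apply: dZ.
    by rewrite in_itv/= z0 (le_trans zy).
  have [z zI] := MVT_segment y0 (fun z zI => dZ' z (subset_itv_oo_cc zI))
    (derive_within_continuous dZ').
  have -> : Z 0 = 0 by rewrite /Z /K !subrr expr0n.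
  rewrite subr0 => ->; rewrite subr0.
  move: zI; rewrite in_itv/= => /andP[z0 zy].
  have := sgn z z0 (le_trans zy y1).
  have [f12|/ltW f21] := leP (f1 z) (f2 z).
    have [HS Hb] := mono _ _ f12 => Heq.
    have K0 : 0 <= K f1 z - K f2 z by rewrite -(pmulr_rge0 _ m0); lra.
    rewrite mulr_le0_ge0// mulr_ge0_le0 ?mulr_ge0//; lra.
  have [HS Hb] := mono _ _ f21 => Heq.
  have K0 : K f1 z - K f2 z <= 0 by rewrite -(pmulr_rle0 _ m0); lra.
  rewrite mulr_le0_ge0// mulr_le0_ge0 ?mulr_ge0_le0//; lra.
move=> y y0 y1.
have /eqP : K f1 y - K f2 y = 0.
  by apply/eqP; rewrite -sqrf_eq0 eq_le sqr_ge0 andbT; exact: Z0.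
rewrite subr_eq0 => /eqP KK; have := sgn y y0 y1; rewrite KK subrr mulr0.
move=> /eqP; rewrite subr_eq0 => /eqP SS.
have lt d1 d2 : d1 < d2 -> S (pi / 2 + atan d1) < S (pi / 2 + atan d2).
  move=> d12; apply: S_lt; last first.
  - by have := atan_ltpi2 d2; lra.
  - by rewrite ltrD2l lt_atan.
  - by have := atan_gtNpi2 d1; lra.
case: (ltgtP (f1 y) (f2 y)) => // /lt; by rewrite SS ltxx.
Qed.

Lemma even_data_slope0 u f g : W22_data u f g ->
  (forall x, x \in `](-1), 1[ -> u x = u (- x)) -> f 0 = 0.
Proof.
move=> dg ev.
have O1 : (-1 < (0 : R)) && ((0 : R) < 1) by rewrite ltrN10 ltr01.
have d0 := data_derive dg O1.
have dN : is_derive (0 : R) 1 (fun x => u (- x)) (f 0 * -1).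
  have di : is_derive (0 : R) 1 (fun x : R => - x) (-1) by apply: is_derive_eq.
  have d0' : is_derive (- 0 : R) 1 u (f 0) by rewrite oppr0.
  exact: (@is_derive_chain_comp R u (fun x : R => - x) 0 _ _ _ d0' di).
have xI : (0 : R) \in `](-1), 1[ by rewrite in_itv/=.
have [_ E1] : is_derive (0 : R) 1 u (f 0 * -1).
  by apply: near_eq_is_derive dN; apply: filterS (near_in_itvoo xI) => y yI; rewrite -ev.
by have [_] := d0; rewrite E1; lra.
Qed.

Lemma right_unique u1 u2 f1 f2 g1 g2 al m : 0 < al < pi / 2 -> 0 < m ->
  W22_data u1 f1 g1 -> W22_data u2 f2 g2 -> u1 1 = 0 -> u2 1 = 0 ->
  (forall y, 0 <= y -> y <= 1 -> S (pi / 2 + atan (f1 y)) - S (pi / 2) +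
    m * Rintegral mu `[0, y] (fun z => b al (f1 z)) = 0) ->
  (forall y, 0 <= y -> y <= 1 -> S (pi / 2 + atan (f2 y)) - S (pi / 2) +
    m * Rintegral mu `[0, y] (fun z => b al (f2 z)) = 0) ->
  forall y, 0 <= y -> y <= 1 -> u1 y = u2 y.
Proof.
move=> aI m0 [[[cf1 _ _] _] uf1] [[[cf2 _ _] _] uf2] u11 u21 eq1 eq2 y y0 y1.
have N1y : -1 <= y by lra.
have := uf1 y 1 N1y y1 (lexx _); have := uf2 y 1 N1y y1 (lexx _).
rewrite u11 u21 (@eq_Rintegral _ _ _ mu _ f2 f1); first by lra.
move=> z; rewrite inE/= in_itv/= => /andP[yz z1].
by rewrite (right_equation_unique aI m0 cf1 cf2 eq1 eq2)// (le_trans y0).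
Qed.

End uniqueness.

(** * Profile of the free elastica *)

Section profile.
Variable R : realType.
Local Notation mu := (@lebesgue_measure R).
Implicit Types (u f g phi : R -> R) (x y z al l m : R).

Lemma antiderivative phi : continuous phi ->
  exists F : R -> R, forall x, is_derive x 1 F (phi x).
Proof.
(* An integral over [[0, x]] would be 0 for negative [x]. The base point moves so as to lie below
   both [x] and 0; the difference of integrals does not depend on it. *)
move=> cphi; pose base x : R := - (`|x| + 1).
exists (fun x => Rintegral mu `[base x, x] phi - Rintegral mu `[base x, 0] phi) => x.
pose B : R := - (`|x| + 2).
have Bx : B < x by rewrite /B; have := ler_norm (- x); rewrite normrN; lra.
have d1 : is_derive x 1 (fun y => Rintegral mu `[B, y] phi - Rintegral mu `[B, 0] phi) (phi x).
  have := is_derive_Rintegral Bx cphi => H.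
  by rewrite -[phi x]subr0; exact: is_deriveB.
have xI : x \in `]x - 1, x + 1[ by rewrite in_itv/= ltrBlDr ltrDl ltr01.
apply: near_eq_is_derive d1; apply: filterS (near_in_itvoo xI) => y.
rewrite in_itv/= => /andP[y1 y2].
have yx : `|y - x| <= 1 by rewrite ler_norml; apply/andP; split; lra.
have Bb : B <= base y.
  rewrite /B /base lerN2; have := ler_normD (y - x) x; rewrite subrK; lra.
have by1 : base y <= y by rewrite /base; have := ler_norm (- y); rewrite normrN; lra.
have b0 : base y <= 0 by rewrite /base; have := normr_ge0 y; lra.
rewrite (Rintegral_split Bb by1 (continuous_integrable _ _ cphi)).
by rewrite (Rintegral_split Bb b0 (continuous_integrable _ _ cphi)); ring.
Qed.

Lemma rtsin_lt al x y : al < pi / 2 -> 0 <= x -> x < y -> y <= al -> rtsin x < rtsin y.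
Proof.
move=> alp x0 xy ya; have p0 := @pi_gt0 R.
have s0 : 0 < sin y by apply: sin_gt0_pi; apply/andP; split; lra.
by rewrite ltr_sqrt// ltr_sin// in_itv/=; apply/andP; split; lra.
Qed.

(** [psi] is the angle of the arc with its inflection tangent. Its equation is separable but not
    Lipschitz at 0, so it is solved by inversion: [Th0] is a primitive of [cos (al - y) / rtsin y],
    and [Th0 (psi x) = D al * (1 - x / l)] on [[0, l]]. *)
Lemma angle_profile al l : 0 < al < pi / 2 -> 0 < l ->
  exists psi : R -> R, [/\ continuous psi, (forall x, 0 <= psi x <= al),
    psi 0 = al, (forall x, l <= x -> psi x = 0) &
    forall x, 0 < x -> x < l ->
      is_derive x 1 psi (- (D al / l * rtsin (psi x) / cos (al - psi x)))].
Proof.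
move=> aI l0; have [a0 ap] := andP aI; have D0 := D_gt0 aI.
have s0 := sin_gt0_pihalf aI; have k0 := cos_gt0_ph aI; have p0 := @pi_gt0 R.
pose Th0 (y : R) := 2 * cos al * rtsin y + sin al * S y.
pose clip (y : R) : R := Num.max 0 (Num.min y al).
(* [Th] extends [Th0], restricted to [0, al], by slope 1 to an increasing
   bijection of R, whose inverse is continuous everywhere. *)
pose Th y := Th0 (clip y) + (y - clip y).
have clipI y : 0 <= clip y <= al.
  by rewrite le_max lexx/= ge_max (ltW a0)/= ge_min lexx orbT.
have clip_id y : 0 <= y -> y <= al -> clip y = y.
  by move=> y0 ya; rewrite /clip min_l// max_r.
have clip_le y : y <= 0 -> clip y = 0.
  by move=> y0; rewrite /clip min_l ?max_l// (le_trans y0)// ltW.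
have clip_ge y : al <= y -> clip y = al.
  by move=> ya; rewrite /clip min_r// max_r// ltW.
have Th00 : Th0 0 = 0 by rewrite /Th0 rtsin0 S0 !mulr0 addr0.
have Th0al : Th0 al = D al by rewrite /Th0 /D; ring.
have Th0_lt x y : 0 <= x -> x < y -> y <= al -> Th0 x < Th0 y.
  move=> x0 xy ya; apply: ltrD.
    by rewrite ltr_pM2l ?mulr_gt0// (rtsin_lt ap).
  by rewrite ltr_pM2l// S_lt//; lra.
have clip_nd x y : x <= y -> clip x <= clip y /\ x - clip x <= y - clip y.
  move=> xy; have [x0|x0] := leP x 0.
    rewrite (clip_le _ x0); split; first by case/andP: (clipI y).
    have [y0|y0] := leP y 0; first by rewrite clip_le//; lra.
    have [ya|/ltW ya] := leP y al; first by rewrite (clip_id _ (ltW y0) ya); lra.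
    by rewrite clip_ge//; lra.
  have [ya|/ltW ya] := leP y al.
    have y0 : 0 <= y by lra.
    have xa : x <= al by lra.
    by rewrite (clip_id _ y0 ya) (clip_id _ (ltW x0) xa); split; lra.
  rewrite (clip_ge y ya); split; first by case/andP: (clipI x).
  have [xa|/ltW xa] := leP x al; first by rewrite (clip_id _ (ltW x0) xa); lra.
  by rewrite clip_ge//; lra.
have Th_lt x y : x < y -> Th x < Th y.
  move=> xy; have [c1 c2] := clip_nd x y (ltW xy).
  have [/andP[cx _] /andP[_ cy]] := (clipI x, clipI y).
  move: c1; rewrite le_eqVlt => /orP[/eqP cE|c1].
    by rewrite /Th cE ltrD2l; lra.
  by apply: ltr_leD => //; exact: Th0_lt.
have Th_inj : injective Th.
  by move=> x y E; case: (ltgtP x y) => // /Th_lt; rewrite E ltxx.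
have cclip : continuous clip.
  move=> x; have cid : {for x, continuous (fun y : R => y)} by exact: cvg_id.
  have ccst (d : R) : {for x, continuous (fun _ : R => d)} by exact: cvg_cst.
  exact: (continuous_max (ccst 0) (continuous_min cid (ccst al))).
have cTh0 y : -4 < y -> {for y, continuous Th0}.
  move=> y4; apply: cvgD; apply: cvgM.
  - exact: cvg_cst.
  - exact: continuous_rtsin.
  - exact: cvg_cst.
  - exact: continuous_S.
have cTh : continuous Th.
  move=> y; have c1 : {for y, continuous (fun y => Th0 (clip y))}.
    apply: continuous_comp; first exact: cclip.
    by apply: cTh0; case/andP: (clipI y) => + _; lra.
  by apply: cvgD c1 _; apply: cvgB; [exact: cvg_id|exact: cclip].
have Th0E : Th 0 = 0 by rewrite /Th clip_id ?Th00 ?subrr ?addr0// ltW.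
have ThalE : Th al = D al by rewrite /Th clip_ge// Th0al subrr addr0.
have surj z : exists y, Th y = z.
  have lo : Th (- `|z|) = - `|z|.
    by rewrite /Th clip_le ?Th00 ?subr0 ?add0r// oppr_le0.
  have hi : Th (al + `|z|) = D al + `|z|.
    by rewrite /Th clip_ge ?lerDl// Th0al; ring.
  have z0 := normr_ge0 z; have z1 := ler_norm z; have z2 := ler_norm (- z).
  have le : - `|z| <= al + `|z| by lra.
  have [|y _ yE] := @IVT R Th _ _ z le (continuous_subspaceT cTh).
    by rewrite lo hi ge_min le_max; move: z2; rewrite normrN => z2;
      apply/andP; split; apply/orP; [left|right]; lra.
  by exists y.
have [g gE] := choice surj.
have ThK : cancel Th g by move=> y; apply: Th_inj; rewrite gE.
have nearcTh y : {near y, continuous Th} by exact: (@filterE _ (nbhs y) _ _ cTh).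
have nearThK y : {near y, cancel Th g} by exact: (@filterE _ (nbhs y) _ _ ThK).
have cg : continuous g.
  move=> z; rewrite -(gE z).
  exact: nbhs_singleton (near_can_continuous (nearThK (g z)) (nearcTh (g z))).
have g_lt z1 z2 : z1 < z2 -> g z1 < g z2.
  move=> z12; rewrite ltNge; apply/negP; rewrite le_eqVlt => /orP[/eqP E|/Th_lt].
    by move: z12; rewrite -(gE z1) -(gE z2) E ltxx.
  by rewrite !gE ltNge ltW.
have g0 : g 0 = 0 by rewrite -[in LHS]Th0E ThK.
have gD : g (D al) = al by rewrite -ThalE ThK.
pose arg x := D al * (1 - x / l).
have carg : continuous arg.
  move=> x; apply: cvgM; first exact: cvg_cst.
  apply: cvgB; first exact: cvg_cst.
  by apply: cvgM; [exact: cvg_id|exact: cvg_cst].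
exists (fun x => clip (g (arg x))); split.
- move=> x; apply: continuous_comp; last exact: cclip.
  by apply: continuous_comp; [exact: carg|exact: cg].
- by move=> x; exact: clipI.
- by rewrite /arg mul0r subr0 mulr1 gD clip_ge.
- move=> x lx; apply: clip_le; rewrite -g0.
  have : arg x <= 0.
    by rewrite /arg pmulr_rle0// subr_le0 ler_pdivlMr// mul1r.
  by rewrite le_eqVlt => /orP[/eqP ->//|/g_lt/ltW].
- move=> x x0 xl.
  have inner y : y \in `]0, l[ -> 0 < g (arg y) < al.
    rewrite in_itv/= => /andP[y0 yl]; rewrite -{1}g0 -{1}gD; apply/andP; split; apply: g_lt.
      by rewrite /arg mulr_gt0// subr_gt0 ltr_pdivrMr// mul1r.
    by rewrite /arg -[ltRHS]mulr1 ltr_pM2l// ltrBlDr ltrDl divr_gt0.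
  have xI : x \in `]0, l[ by rewrite in_itv/= x0.
  have near_id : \forall y \near x, g (arg y) = clip (g (arg y)).
    apply: filterS (near_in_itvoo xI) => y /inner/andP[h1 h2].
    by rewrite (clip_id _ (ltW h1) (ltW h2)).
  have [i1 i2] := andP (inner x xI).
  rewrite (clip_id _ (ltW i1) (ltW i2)).
  apply: near_eq_is_derive near_id _.
  set ps := g (arg x) in i1 i2 *.
  have psI : 0 < ps < pi / 2 by rewrite i1 (lt_trans i2).
  have sp := sin_gt0_pihalf psI; have rp := rtsin_gt0 sp.
  have dr := is_derive_rtsin sp.
  have ps4 : -4 < ps by lra.
  have dS := is_derive_S ps4.
  have kd : 0 < cos (al - ps) by apply: cos_gt0_ph; apply/andP; split; lra.
  have dTh0 : is_derive ps 1 Th0 (cos (al - ps) / rtsin ps).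
    rewrite /Th0; apply: is_derive_eq; rewrite /GRing.scale/= cosB.
    by rewrite -(sqr_rtsin (ltW sp)); field; rewrite gt_eqF.
  have psI' : ps \in `]0, al[ by rewrite in_itv/= i1.
  have dTh : is_derive ps 1 Th (cos (al - ps) / rtsin ps).
    apply: near_eq_is_derive dTh0; apply: filterS (near_in_itvoo psI') => y.
    by rewrite in_itv/= => /andP[y0 ya]; rewrite /Th (clip_id _ (ltW y0) (ltW ya)) subrr addr0.
  have dg : is_derive (arg x) 1 g (cos (al - ps) / rtsin ps)^-1.
    rewrite -(gE (arg x)); apply: (is_derive_inverse (nearThK ps) (nearcTh ps) dTh).
    by rewrite mulf_neq0 ?invr_eq0 ?gt_eqF.
  have darg : is_derive x 1 arg (- (D al / l)).
    by rewrite /arg; apply: is_derive_eq; rewrite /GRing.scale/=; ring.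
  apply: (is_derive_chain_comp dg darg); field.
  by rewrite !gt_eqF.
Qed.

End profile.

(** * Competitors *)

Section competitor.
Variable R : realType.
Local Notation mu := (@lebesgue_measure R).
Implicit Types (u f g phi : R -> R) (x y z al l m : R).

(** Along a solution of the first order equation the square vanishes. The first formula computes the
    energy; equating it with the second determines the height of the curve. *)
Lemma critical_energy f g s t al m : s <= t -> 0 <= al -> ac2 f g s t ->
  (forall x, x \in `[s, t] -> 0 <= sin al + f x * cos al) ->
  (forall x, x \in `[s, t] -> a (f x) * g x = - (m * b al (f x))) ->
  E f g s t = - m * (S (al + atan (f t)) - S (al + atan (f s))) /\
  E f g s t = m ^+ 2 * Rintegral mu `[s, t] (fun x => sin al + f x * cos al).
Proof.
move=> st al0 ac2f pos crit.
have := square_integral m st al0 ac2f pos.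
rewrite (@eq_Rintegral _ _ _ mu _ (fun=> 0)); last first.
  by move=> x; rewrite inE/= => xI; rewrite crit// addNr expr0n.
rewrite Rintegral_cst// mul0r.
have [[cf _ _] _] := ac2f.
have -> : m ^+ 2 * Rintegral mu `[s, t] (fun x => sin al + f x * cos al) = E f g s t.
  rewrite -RintegralZl//; last exact/continuous_integrable/continuous_height.
  apply: eq_Rintegral => x; rewrite inE/= => xI.
  by rewrite -(sqr_b (pos x xI)) -sqr_a -!exprMn crit// sqrrN.
by move: (E f g s t) => E1 H; split=> //; lra.
Qed.

Lemma is_derive_oppx f x (d : R) : is_derive (- x) 1 f d ->
  is_derive x 1 (fun y => f (- y)) (- d).
Proof.
move=> df; have di : is_derive x 1 (fun y : R => - y) (-1) by apply: is_derive_eq.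
by apply: (is_derive_chain_comp df di); rewrite mulrN1.
Qed.

Lemma atanN_tan x : 0 <= x -> x < pi / 2 -> atan (- tan x) = - x.
Proof. by move=> x0 xp; rewrite atanN tanK// in_itv/= xp andbT; lra. Qed.

Lemma critical_point al ps : 0 < al < pi / 2 -> 0 <= ps <= al ->
  b al (- tan (al - ps)) = rtsin ps / Num.sqrt (cos (al - ps)) /\
  0 <= sin al + - tan (al - ps) * cos al.
Proof.
move=> /andP[a0 ap] /andP[p0 pa].
have kd : 0 < cos (al - ps) by apply: cos_gt0_pihalf; apply/andP; split; lra.
have sE : sin al + - tan (al - ps) * cos al = sin ps / cos (al - ps).
  have -> : sin ps = sin (al - (al - ps)) by congr sin; ring.
  by rewrite sinB /tan; field; rewrite gt_eqF.
have s0 : 0 <= sin ps by apply: sin_ge0_pi; have := @pi_gt0 R; lra.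
rewrite sE; split; last by rewrite divr_ge0// ltW.
by rewrite /b sE sqrtrM// sqrtrV// ltW.
Qed.

(** An arc over [[-l, l]] continued by segments of slope [tan al] in absolute value. The estimate
    [tan al * (1 - l) <= u 0] serves tall obstacles, where the segments alone reach the tip; the
    formula for [sin al - u 0 * cos al] fixes [u 0] when [l = 1]. *)
Lemma competitor al l : 0 < al < pi / 2 -> 0 < l -> l <= 1 ->
  exists u f g, [/\ W22_rep u f g /\ W22_data u f g,
    E f g (-1) 1 = 2 * (S al * D al / l),
    (forall x, u (- x) = u x) /\ u 1 = 0,
    (forall x, 0 < x -> x < 1 -> (1 - x) * u 0 <= u x) &
    tan al * (1 - l) <= u 0 /\ sin al - u 0 * cos al = S al * l / D al].
Proof.
move=> aI l0 l1; have [a0 ap] := andP aI.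
have [psi [cpsi psiI psi0 psil dpsi]] := angle_profile aI l0.
have D0 := D_gt0 aI; have s0 := sin_gt0_pihalf aI; have k0 := cos_gt0_ph aI.
pose m := D al / l; have m0 : 0 < m by rewrite divr_gt0.
have kd x : 0 < cos (al - psi x).
  by have /andP[p0 pa] := psiI x; apply: cos_gt0_pihalf; apply/andP; split; lra.
have rp x : 0 <= rtsin (psi x) by exact: rtsin_ge0.
pose V x := m * rtsin (psi x) / cos (al - psi x) ^+ 3.
have V0 x : 0 <= V x by apply: divr_ge0; [exact: mulr_ge0 (ltW m0) (rp x)|exact/exprn_ge0/ltW].
have carg : continuous (fun x => al - psi x).
  by move=> x; apply: cvgB; [exact: cvg_cst|exact: cpsi].
have cV : continuous V.
  move=> x; have ck : {for x, continuous (fun x => cos (al - psi x))}.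
    by apply: continuous_comp; [exact: carg|exact: continuous_cos].
  have cr : {for x, continuous (fun x => rtsin (psi x))}.
    by apply: continuous_comp; [exact: cpsi|exact: continuous_rtsin].
  apply: cvgM; first by apply: cvgM; [exact: cvg_cst|exact: cr].
  apply: cvgV; first by rewrite expf_neq0// gt_eqF.
  exact: (cvgM ck (cvgM ck ck)).
(* Integrating an even continuous function twice avoids gluing pieces: [f] comes out odd and [u]
   even, and [f] is identified with [- tan (al - psi)] afterwards. Beyond [l], [V] is 0 because
   [rtsin 0 = 0]. *)
pose g x := - V `|x|.
have cg : continuous g.
  move=> x; apply: cvgN; have cn : {for x, continuous (fun y : R => `|y|)}.
    exact: norm_continuous.
  by apply: (@continuous_comp _ _ _ (fun y : R => `|y|) V x cn); exact: cV.
have [F dF] := antiderivative cg.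
pose f x := F x - F 0.
have df x : is_derive x 1 f (g x).
  by rewrite -[g x]subr0; exact: is_deriveB.
have cf : continuous f by move=> x; exact: is_derive_continuous (df x).
have [P dP] := antiderivative cf.
pose u x := P x - P 1.
have du x : is_derive x 1 u (f x).
  by rewrite -[f x]subr0; exact: is_deriveB.
have f0 : f 0 = 0 by rewrite /f subrr.
have fodd x : f (- x) = - f x.
  have dsum z : is_derive z 1 (fun y => f (- y) + f y) 0.
    have := is_derive_oppx (df (- z)) => dN.
    have -> : 0 = - g (- z) + g z by rewrite /g normrN addNr.
    exact: is_deriveD.
  have := is_derive_0_is_cst x 0 dsum; rewrite oppr0 f0 addr0 => /eqP.
  by rewrite addr_eq0 => /eqP.
have ueven x : u (- x) = u x.
  have ddif z : is_derive z 1 (fun y => u (- y) - u y) 0.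
    have := is_derive_oppx (du (- z)) => dN.
    have -> : 0 = - f (- z) - f z by rewrite fodd opprK subrr.
    exact: is_deriveB.
  have := is_derive_0_is_cst x 0 ddif; rewrite oppr0 subrr => /eqP.
  by rewrite subr_eq0 => /eqP.
have u1 : u 1 = 0 by rewrite /u subrr.
pose T x := tan (al - psi x).
have cT : continuous T.
  move=> x; apply: (@continuous_comp _ _ _ (fun x => al - psi x) tan x (carg x)).
  by apply: continuous_tan; rewrite gt_eqF.
have dT x : 0 < x -> x < l -> is_derive x 1 T (V x).
  move=> x0 xl; have dp := dpsi x x0 xl.
  have kn : cos (al - psi x) != 0 by rewrite gt_eqF.
  have dt := is_derive_tan kn.
  have da : is_derive x 1 (fun x => al - psi x) (m * rtsin (psi x) / cos (al - psi x)).
    by apply: is_derive_eq; rewrite /m; ring.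
  by apply: (@is_derive_chain_comp R tan (fun x => al - psi x) x _ _ _ dt da); rewrite /V; field.
have fT1 x : 0 <= x -> x <= l -> f x = - T x.
  move=> x0 xl.
  have dz z : z \in `]0, x[ -> is_derive z 1 (fun y => f y + T y) 0.
    rewrite in_itv/= => /andP[z0 zx].
    have d1 := df z; have d2 := dT z z0 (lt_le_trans zx xl).
    have -> : 0 = g z + V z by rewrite /g ger0_norm ?ltW// addNr.
    exact: is_deriveD.
  have cz : {within `[0, x], continuous (fun y => f y + T y)}.
    by apply: continuous_subspaceT => y; apply: cvgD; [exact: cf|exact: cT].
  have := is_derive_cst_itv x0 dz cz.
  rewrite f0 add0r /T psi0 subrr tan0 => /eqP.
  by rewrite addr_eq0 => /eqP.
have fT x : 0 <= x -> f x = - T x.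
  move=> x0; have [xl|/ltW lx] := leP x l; first exact: fT1.
  have dz z : z \in `]l, x[ -> is_derive z 1 f 0.
    rewrite in_itv/= => /andP[lz zx].
    have := df z; rewrite /g ger0_norm; last by lra.
    by rewrite /V (psil z (ltW lz)) rtsin0 mulr0 mul0r oppr0.
  rewrite (is_derive_cst_itv lx dz (continuous_subspaceT cf)) (fT1 l (ltW l0) (lexx _)).
  by rewrite /T !psil.
have pos x : 0 <= x -> 0 <= sin al + f x * cos al.
  by move=> x0; rewrite fT//; have [_] := critical_point aI (psiI x).
have aE x : 0 <= x -> a (f x) * V x = m * b al (f x).
  move=> x0; have [bE _] := critical_point aI (psiI x).
  have /andP[p0 pa] := psiI x.
  rewrite fT// bE /a /k atanN_tan ?cosN; [|lra|lra].
  have q0 : 0 < Num.sqrt (cos (al - psi x)) by rewrite sqrtr_gt0.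
  move: q0 (esym (sqr_sqrtr (ltW (kd x)))); rewrite /V.
  set q := Num.sqrt _ => q0 cE; rewrite cE; field.
  by rewrite gt_eqF.
have [rep dat] := smooth_W22_rep cg (fun x _ => df x) cf (fun x _ => du x).
have N10 : -1 <= 0 :> R by lra.
have f1 : al + atan (f 1) = 0.
  by rewrite fT// /T psil// subr0 atanN_tan ?subrr// ltW.
have [ac2f uf] := dat.
have acr : ac2 f g 0 1 := ac2_sub N10 (lexx _) ac2f.
have acl := ac2N (ac2_sub (lexx _) ler01 ac2f).
have al0' := ltW a0.
have [Er Er2] : E f g 0 1 = - m * (S (al + atan (f 1)) - S (al + atan (f 0))) /\
    E f g 0 1 = m ^+ 2 * Rintegral mu `[0, 1] (fun x => sin al + f x * cos al).
  apply: critical_energy => // x; rewrite in_itv/= => /andP[x0 x1]; first exact: pos.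
  by rewrite /g ger0_norm// mulrN aE.
have [El _] : E (fun x => - f x) (fun x => - g x) (-1) 0 =
      - - m * (S (al + atan (- f 0)) - S (al + atan (- f (-1)))) /\
    E (fun x => - f x) (fun x => - g x) (-1) 0 =
      (- m) ^+ 2 * Rintegral mu `[-1, 0] (fun x => sin al + (- f x) * cos al).
  apply: critical_energy => // x; rewrite in_itv/= => /andP[x0 x1]; rewrite -fodd.
    by apply: pos; lra.
  by rewrite /g ler0_norm// opprK aE ?oppr_ge0// mulNr opprK.
have N11 : -1 < 0 :> R by lra.
have Sal : E f g 0 1 = m * S al by rewrite Er f1 f0 atan0 addr0 S0; ring.
have Sal' : E f g (-1) 0 = m * S al.
  by rewrite -EN El fodd !opprK f1 f0 oppr0 atan0 addr0 S0; ring.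
have uint := data_right dat N11 ltr01 u1.
rewrite (height_integral _ ler01 cf uint) subr0 mul1r in Er2.
have f_ni x y : x <= y -> f y <= f x.
  move=> xy; have [z _] := MVT_between x y df.
  rewrite -subr_le0 => ->; rewrite mulr_le0_ge0 ?subr_ge0//.
  by rewrite /g oppr_le0.
have u_MVT x y : x <= y -> exists2 z, x <= z <= y & u y - u x = f z * (y - x).
  by move=> xy; have [z] := MVT_between x y du; rewrite min_l// max_r//; exists z.
exists u, f, g; split=> //.
- by rewrite (E_split N10 ler01 ac2f) Sal Sal' /m; ring.
- move=> x x0 x1.
  have [z1 /andP[z10 z1x] E1] := u_MVT 0 x (ltW x0).
  have [z2 /andP[xz2 z21] E2] := u_MVT x 1 (ltW x1).
  have f12 := f_ni z1 z2 (le_trans z1x xz2).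
  rewrite u1 in E2; have : 0 <= (f z1 - f z2) * (x * (1 - x)).
    by rewrite mulr_ge0 ?subr_ge0// mulr_ge0 ?subr_ge0// ltW.
  move: E1 E2; rewrite subr0 sub0r => E1 E2 H.
  have -> : u x = - (f z2 * (1 - x)) by rewrite -E2 opprK.
  have -> : u 0 = - (f z2 * (1 - x)) - f z1 * x by rewrite -E2 -E1; ring.
  by rewrite -subr_ge0; apply: le_trans H _; rewrite le_eqVlt; apply/orP; left; apply/eqP; ring.
split.
  have [z /andP[lz z1] E1] := u_MVT l 1 l1.
  have [y /andP[y0 yl] E2] := u_MVT 0 l (ltW l0).
  have fz : f z = - tan al by rewrite fT ?(le_trans (ltW l0))// /T psil// subr0.
  have fy : f y * l <= 0 by rewrite mulr_le0_ge0 ?(ltW l0)// -f0 f_ni.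
  move: E1 E2; rewrite u1 fz subr0 sub0r mulNr => /oppr_inj E1 E2.
  by rewrite -E1 -subr_le0 E2.
have mm : m ^+ 2 * (sin al - u 0 * cos al) = m * S al by rewrite -Er2 Sal.
have mE : m * (sin al - u 0 * cos al) = S al.
  by apply: (mulfI (lt0r_neq0 m0)); rewrite -mm; ring.
by rewrite -mE /m; field; rewrite !gt_eqF.
Qed.

End competitor.

(** * Minimizers *)

Section minimizers.
Variable R : realType.
Local Notation mu := (@lebesgue_measure R).
Local Notation c := (c_star R).
Implicit Types (psi u v f g : R -> R) (x al e : R).

(** Continuity carries the affine formula to both endpoints, so [psi 0 = q] and [psi 1 = p + q < 0],
    and the claim is [x * (p + q) <= 0]. *)
Lemma affine_le_chord psi p q : {within `[(-1 : R), 1], continuous psi} ->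
  (forall x, x \in `](0 : R), 1[ -> psi x = p * x + q) -> psi 1 < 0 ->
  forall x, x \in `](0 : R), 1[ -> psi x <= (1 - x) * psi 0.
Proof.
move=> cpsi aff psi1; pose F x := psi x - (p * x + q).
have dF x : x \in `](0 : R), 1[ -> is_derive x 1 F 0.
  move=> xI; have dc : is_derive x 1 (fun=> 0 : R) 0 by exact: is_derive_cst.
  apply: near_eq_is_derive dc; apply: filterS (near_in_itvoo xI) => y yI.
  by rewrite /F aff// subrr.
have cF : {within `[(0 : R), 1], continuous F}.
  have cpsi' : {within `[(0 : R), 1], continuous psi}.
    by apply: continuous_subspaceW cpsi; apply: subset_itv; rewrite bnd_simp//; lra.
  have ca : {within `[(0 : R), 1], continuous (fun x => p * x + q)}.
    apply: continuous_subspaceT => x; apply: cvgD; last exact: cvg_cst.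
    by apply: cvgM; [exact: cvg_cst|exact: cvg_id].
  by move=> x; apply: cvgB; [exact: cpsi'|exact: ca].
have Fcst x y : 0 <= x -> x <= y -> y <= 1 -> F y = F x.
  move=> x0 xy y1; have dF' z : z \in `]x, y[ -> is_derive z 1 F 0.
    rewrite in_itv/= => /andP[xz zy]; apply: dF.
    by rewrite in_itv/= (le_lt_trans x0 xz) (lt_le_trans zy y1).
  have cF' : {within `[x, y], continuous F}.
    by apply: continuous_subspaceW cF; apply: subset_itv; rewrite bnd_simp.
  exact: is_derive_cst_itv xy dF' cF'.
move=> x xI; move: (xI); rewrite in_itv/= => /andP[x0 x1].
have := Fcst 0 x (lexx _) (ltW x0) (ltW x1).
have := Fcst x 1 (ltW x0) (ltW x1) (lexx _).
rewrite /F (aff x xI) subrr mulr0 mulr1 add0r => E1 E0.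
have -> : psi 0 = q by lra.
have : p + q < 0 by lra.
by nra.
Qed.

Lemma competitor_Xpsi_sym psi u : {within `[(-1 : R), 1], continuous psi} ->
  (forall x, x \in `[(-1 : R), 1] -> psi x = psi (- x)) ->
  (exists p q : R, forall x, x \in `](0 : R), 1[ -> psi x = p * x + q) ->
  psi 1 < 0 -> W22 u -> (forall x, u (- x) = u x) -> u 1 = 0 ->
  (forall x, 0 < x -> x < 1 -> (1 - x) * u 0 <= u x) -> psi 0 <= u 0 ->
  Xpsi_sym psi u.
Proof.
move=> cpsi epsi [p [q aff]] psi1 Wu ev u1 cu u0.
have le x : 0 < x -> x < 1 -> psi x <= u x.
  move=> x0 x1; have xI : x \in `](0 : R), 1[ by rewrite in_itv/= x0.
  apply: le_trans (affine_le_chord cpsi aff psi1 xI) _.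
  by apply: le_trans (cu x x0 x1); rewrite ler_wpM2l// subr_ge0 ltW.
split; last by move=> x _; rewrite ev.
split=> //; split; first by rewrite ev.
split=> // x; rewrite in_itv/= => /andP[x1 x2].
have [x0|x0|->//] := ltgtP x 0; last exact: le.
have xI : x \in `[(-1 : R), 1] by rewrite in_itv/= !ltW.
by rewrite (epsi x xI) -(ev x); apply: le; rewrite ?oppr_gt0// ltrNl.
Qed.

Lemma B_le_E u f g : W22_rep u f g -> W22_data u f g -> (B u <= (E f g (-1) 1)%:E)%E.
Proof.
move=> rep dat; have [_ <-] := data_W22_rep dat rep.
by apply: ereal_inf_lbound; exists f, g.
Qed.

Lemma Xpsi_data psi u : Xpsi psi u -> exists f g, W22_data u f g.
Proof. by move=> [[du [ddu /W22_rep_data[f dat _]]] _]; exists f, ddu. Qed.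

Lemma Xpsi_ge0 psi u : Xpsi psi u -> [/\ u (-1) = 0, u 1 = 0 & psi 0 <= u 0].
Proof. by move=> [_ [uN1 [u1 ge]]]; split=> //; apply: ge; rewrite in_itv/= ltrN10 ltr01. Qed.

Lemma tall_energy psi u : 0 < psi 0 -> h_star R <= psi 0 -> Xpsi psi u ->
  ~ (B u <= (2 * c ^+ 2)%:E)%E.
Proof.
move=> psi0 hpsi Xu; have [f [g dat]] := Xpsi_data Xu.
have [uN1 u1 u0] := Xpsi_ge0 Xu.
have [x [x1 x2 fx ux]] := data_max dat uN1 u1 (lt_le_trans psi0 u0).
have hux : h_star R <= u x := le_trans hpsi (le_trans u0 ux).
have ux0 : 0 < u x := lt_le_trans psi0 (le_trans u0 ux).
have [al [be [aI bI low]]] := two_sided_energy dat x1 x2 uN1 u1 fx ux0.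
(* The widths add up to 2, so the position [x] of the maximum drops out of the sum. *)
have ba := side_bound (1 - x) aI hux; have bb := side_bound (x + 1) bI hux.
apply/negP; rewrite -ltNge.
apply: lt_le_trans (B_ge dat (fun g' d => low g' (c / rtsin al) (c / rtsin be) d)).
rewrite lte_fin; apply: le_lt_trans (ltrD ba bb).
by rewrite le_eqVlt; apply/orP; left; apply/eqP; ring.
Qed.

Lemma tall_inf psi e : {within `[(-1 : R), 1], continuous psi} ->
  (forall x, x \in `[(-1 : R), 1] -> psi x = psi (- x)) ->
  (exists p q : R, forall x, x \in `](0 : R), 1[ -> psi x = p * x + q) ->
  psi 1 < 0 -> 0 < psi 0 -> 0 < e ->
  exists2 u, Xpsi_sym psi u & (B u <= (2 * c ^+ 2 + e)%:E)%E.
Proof.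
move=> cpsi epsi aff psi1 psi0 e0.
have c0 : 0 < 2 * c ^+ 2 by rewrite mulr_gt0// exprn_gt0// c_star_gt0.
(* Chosen so that [2 * c ^+ 2 / l] is the allowed energy; [al] is then steep enough for the segments
   over the remaining width [1 - l] to climb to [psi 0]. *)
pose l := 2 * c ^+ 2 / (2 * c ^+ 2 + e).
have ce : 0 < 2 * c ^+ 2 + e by rewrite addr_gt0.
have l0 : 0 < l by rewrite divr_gt0.
have l1 : l < 1 by rewrite ltr_pdivrMr// mul1r ltrDl.
pose al := atan (psi 0 / (1 - l)).
have l10 : 0 < 1 - l by rewrite subr_gt0.
have aI : 0 < al < pi / 2.
  by rewrite atan_ltpi2 andbT -(@atan0 R) lt_atan// divr_gt0.
have [u [f [g [[rep dat] En [ev u1] cu [ul _]]]]] := competitor aI l0 (ltW l1).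
exists u.
  apply: competitor_Xpsi_sym => //; first by exists f, g.
  by apply: le_trans ul; rewrite atanK divfK// gt_eqF.
apply: le_trans (B_le_E rep dat) _; rewrite lee_fin En mulrA ler_pdivrMr//.
have -> : (2 * c ^+ 2 + e) * l = 2 * c ^+ 2 by rewrite /l mulrC divfK// gt_eqF.
by rewrite ler_pM2l// SD_le.
Qed.

Lemma short_lower psi al u : 0 < psi 0 -> psi 0 < h_star R ->
  0 < al < pi / 2 -> N al = psi 0 * D al -> Xpsi_sym psi u ->
  ((2 * (S al * D al))%:E <= B u)%E.
Proof.
move=> psi0 hpsi aI NhD [Xu ev]; have [f [g dat]] := Xpsi_data Xu.
have [uN1 u1 u0] := Xpsi_ge0 Xu.
have hI : 0 < psi 0 <= 2 by rewrite psi0 (le_trans (ltW hpsi))// h_star_le2.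
have f0 := even_data_slope0 dat ev.
have [al1 [al2 [aI1 aI2 low]]] :=
  two_sided_energy dat (ltrN10 R) ltr01 uN1 u1 f0 (lt_le_trans psi0 u0).
have [m1 _] := side_energy_min hI aI NhD aI1 u0.
have [m2 _] := side_energy_min hI aI NhD aI2 u0.
apply: B_ge dat _ => g' d; apply: le_trans (low g' (D al) (D al) d).
by rewrite subr0 add0r !mul1r mulr_natl mulr2n lerD.
Qed.

Lemma short_equation psi al u : 0 < psi 0 -> psi 0 < h_star R ->
  0 < al < pi / 2 -> N al = psi 0 * D al -> Xpsi_sym psi u ->
  (B u <= (2 * (S al * D al))%:E)%E ->
  exists f g, W22_data u f g /\ forall y, 0 <= y -> y <= 1 ->
    S (pi / 2 + atan (f y)) - S (pi / 2) +
    D al * Rintegral mu `[0, y] (fun z => b al (f z)) = 0.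
Proof.
move=> psi0 hpsi aI NhD [Xu ev] BM; have [f [g dat]] := Xpsi_data Xu.
have [uN1 u1 u0] := Xpsi_ge0 Xu.
have hI : 0 < psi 0 <= 2 by rewrite psi0 (le_trans (ltW hpsi))// h_star_le2.
exists f, g; split=> //.
apply: (right_equation hI aI NhD dat uN1 u1 (even_data_slope0 dat ev) u0) => e e0.
exact: B_approx dat BM e0.
Qed.

End minimizers.

Unset Implicit Arguments. Set Strict Implicit.

Theorem theorem3p1 (R : realType) (psi : R -> R) :
  {within `[(-1 : R), 1], continuous psi} ->
  (forall x, x \in `[(-1 : R), 1] -> psi x = psi (- x)) ->
  (exists a b : R, forall x, x \in `](0 : R), 1[ -> psi x = a * x + b) ->
  psi (-1) < 0 -> psi 1 < 0 -> 0 < psi 0 ->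
  (psi 0 < h_star R ->
     exists u, is_minimizer (Xpsi_sym psi) u /\
       forall v, is_minimizer (Xpsi_sym psi) v ->
         forall x, x \in `[(-1 : R), 1] -> v x = u x) /\
  (h_star R <= psi 0 ->
     (forall u, ~ is_minimizer (Xpsi_sym psi) u) /\
     (forall u, ~ is_minimizer (Xpsi psi) u)).
Proof.
move=> cpsi epsi aff _ psi1 psi0; split=> hpsi; last first.
  (* Stated for any larger class, so that symmetric and general minimizers are excluded alike. *)
  have inf_le Y : Xpsi_sym psi `<=` Y -> (ereal_inf (@B R @` Y) <= (2 * c_star R ^+ 2)%:E)%E.
    move=> XY; apply/lee_addgt0Pr => e e0; rewrite -EFinD.
    have [u Xu Bu] := tall_inf cpsi epsi aff psi1 psi0 e0.
    by apply: le_trans Bu; apply: ereal_inf_lbound; exists u => //; exact: XY.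
  split=> u [Xu Bu].
    by case: Xu => Xu _; apply: (tall_energy psi0 hpsi Xu); rewrite Bu inf_le.
  by apply: (tall_energy psi0 hpsi Xu); rewrite Bu inf_le// => v [].
have hI : 0 < psi 0 < h_star R by rewrite psi0.
have [al aI NhD] := exists_optimal_angle hI.
have [u [f [g [[rep dat] En [ev u1] cu [_ slope]]]]] := competitor aI ltr01 (lexx 1).
have D0 := D_gt0 aI.
(* [N al = psi 0 * D al] and the relation [slope] both express [S al / D al], as
   [sin al - h * cos al] with [h = psi 0] and [h = u 0]. *)
have u0 : u 0 = psi 0.
  have kn : cos al != 0 by rewrite gt_eqF// cos_gt0_ph.
  have HS : S al = D al * (sin al - u 0 * cos al).
    by rewrite slope mulr1 mulrC divfK// gt_eqF.
  apply: (mulIf (lt0r_neq0 D0)); apply: (mulIf kn); rewrite -NhD.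
  apply: subr0_eq; rewrite [LHS](_ : _ =
    (sin al * D al - cos al * N al) - D al * (sin al - u 0 * cos al)); last by ring.
  by rewrite sinD_cosN -HS subrr.
have Xu : Xpsi_sym psi u.
  by apply: competitor_Xpsi_sym => //; [exists f, g|rewrite u0].
have Bu : (B u <= (2 * (S al * D al))%:E)%E.
  by apply: le_trans (B_le_E rep dat) _; rewrite En divr1.
have low v : Xpsi_sym psi v -> ((2 * (S al * D al))%:E <= B v)%E.
  exact: short_lower.
have [fu [gu [datu equ]]] := short_equation psi0 hpsi aI NhD Xu Bu.
exists u; split.
  split=> //; apply/eqP; rewrite eq_le; apply/andP; split.
    by apply: le_trans Bu _; apply: le_ereal_inf_tmp => _ [v Xv <-]; exact: low.
  by apply: ereal_inf_lbound; exists u.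
move=> v [Xv Bv].
have {}Bv : (B v <= (2 * (S al * D al))%:E)%E.
  by rewrite Bv; apply: le_trans Bu; apply: ereal_inf_lbound; exists u.
have [fv [gv [datv eqv]]] := short_equation psi0 hpsi aI NhD Xv Bv.
have [Xv' evv] := Xv; have [vN1 v1 _] := Xpsi_ge0 Xv'.
have pos y : 0 <= y -> y <= 1 -> v y = u y.
  exact: (right_unique aI D0 datv datu v1 u1 eqv equ).
move=> x; rewrite in_itv/= => /andP[x1 x2].
have [x0|/ltW x0] := leP 0 x; first exact: pos.
move: x1; rewrite le_eqVlt => /orP[/eqP <-|x1]; first by rewrite vN1 ev u1.
rewrite evv ?in_itv/= ?x1 ?(le_lt_trans x0)//.
by rewrite pos ?ev//; lra.
Qed.
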